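(* Let $t$ and $s$ be terms in the language of strong quasi-MV* algebras. Then $\mathbb{SQMV^\ast}\models t\approx s$ if and only if $\mathbf{S^*}\models t\approx s$.
   Context: A quasi-MV* algebra is an algebra $\mathbf{A}=\langle A;\oplus,-,{}^{+},{}^{-},0,1\rangle$ of type $\langle 2,1,1,1,0,0\rangle$ (the unary operations ${}^+,{}^-$ are written as superscripts and bind more tightly than $-$, which binds more tightly than $\oplus$; $-1$ denotes $-(1)$) such that for all $x,y,z\in A$: (1) $x\oplus y=y\oplus x$; (2) $(1\oplus x)\oplus(y\oplus(1\oplus z))=((1\oplus x)\oplus y)\oplus(1\oplus z)$; (3) $(x\oplus 1)\oplus 1=1$; (4) $(x\oplus y)\oplus 0=x\oplus y$; (5) $x^{+}\oplus 0=(x\oplus 0)^{+}=1\oplus(-1\oplus x)$ and $x^{-}\oplus 0=(x\oplus 0)^{-}=-1\oplus(1\oplus x)$; (6) $x\oplus y=(x^{+}\oplus y^{+})\oplus(x^{-}\oplus y^{-})$; (7) $0=-0$; (8) $x\oplus(-x)=0$; (9) $-(x\oplus y)=(-x)\oplus(-y)$; (10) $-(-x)=x$; (11) $(-x\oplus(x\oplus y))^{+}=-x^{+}\oplus(x^{+}\oplus y^{+})$; (12) $x\vee y=y\vee x$; (13) $x\vee(y\vee z)=(x\vee y)\vee z$; (14) $x\oplus(y\vee z)=(x\oplus y)\vee(x\oplus z)$; where $x\vee y:=(x^{+}\oplus(-x^{+}\oplus y^{+})^{+})\oplus(x^{-}\oplus(-x^{-}\oplus y^{-})^{+})$. A strong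 quasi-MV* algebra is a quasi-MV* algebra satisfying $x^+=x^+\oplus 0$ and $x^-=x^-\oplus 0$ for all $x$; $\mathbb{SQMV^\ast}$ denotes the variety of strong quasi-MV* algebras. Terms in the language of strong quasi-MV* algebras are built from variables and the constants $0,1$ using $\oplus,-,{}^+,{}^-$; for an algebra or class $K$, $K\models t\approx s$ means $t$ and $s$ take equal values under every assignment of the variables in every algebra of $K$. The square standard strong quasi-MV* algebra $\mathbf{S^*}$ has universe $S^*=[-1,1]\times[-1,1]\subseteq\mathbb{R}^2$ with $\langle a,b\rangle\oplus\langle c,d\rangle=\langle\max\{-1,\min\{1,a+c\}\},0\rangle$, $-\langle a,b\rangle=\langle -a,-b\rangle$, $\langle a,b\rangle^+=\langle\max\{0,a\},0\rangle$, $\langle a,b\rangle^-=\langle\min\{0,a\},0\rangle$, $0=\langle 0,0\rangle$, $1=\langle 1,0\rangle$. *)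

(* Defs.v *)
From Stdlib Require Import Reals Lra.
Open Scope R_scope.

Inductive term : Type :=
  | tvar : nat -> term
  | tzero : term
  | tone : term
  | toplus : term -> term -> term
  | tneg : term -> term
  | tplus : term -> term
  | tminus : term -> term.

Record alg : Type := Alg {
  car :> Type;
  aoplus : car -> car -> car;
  aneg : car -> car;
  aplus : car -> car;
  aminus : car -> car;
  azero : car;
  aone : car }.

Fixpoint eval (A : alg) (v : nat -> car A) (t : term) : car A :=
  match t with
  | tvar n => v n
  | tzero => azero A
  | tone => aone A
  | toplus t1 t2 => aoplus A (eval A v t1) (eval A v t2)
  | tneg t1 => aneg A (eval A v t1)
  | tplus t1 => aplus A (eval A v t1)
  | tminus t1 => aminus A (eval A v t1)
  end.

Definition ajoin (A : alg) (x y : car A) : car A :=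
  aoplus A
    (aoplus A (aplus A x) (aplus A (aoplus A (aneg A (aplus A x)) (aplus A y))))
    (aoplus A (aminus A x) (aplus A (aoplus A (aneg A (aminus A x)) (aminus A y)))).

Definition is_qmvstar (A : alg) : Prop :=
  let o := aoplus A in let n := aneg A in let p := aplus A in
  let m := aminus A in let z := azero A in let u := aone A in
  let j := ajoin A in
  (forall x y : car A, o x y = o y x) /\
  (forall x y w : car A,
      o (o u x) (o y (o u w)) = o (o (o u x) y) (o u w)) /\
  (forall x : car A, o (o x u) u = u) /\
  (forall x y : car A, o (o x y) z = o x y) /\
  (forall x : car A, o (p x) z = p (o x z) /\ p (o x z) = o u (o (n u) x)) /\
  (forall x : car A, o (m x) z = m (o x z) /\ m (o x z) = o (n u) (o u x)) /\
  (forall x y : car A, o x y = o (o (p x) (p y)) (o (m x) (m y))) /\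
  z = n z /\
  (forall x : car A, o x (n x) = z) /\
  (forall x y : car A, n (o x y) = o (n x) (n y)) /\
  (forall x : car A, n (n x) = x) /\
  (forall x y : car A, p (o (n x) (o x y)) = o (n (p x)) (o (p x) (p y))) /\
  (forall x y : car A, j x y = j y x) /\
  (forall x y w : car A, j x (j y w) = j (j x y) w) /\
  (forall x y w : car A, o x (j y w) = j (o x y) (o x w)).

Definition is_sqmvstar (A : alg) : Prop :=
  is_qmvstar A /\
  (forall x : car A, aplus A x = aoplus A (aplus A x) (azero A)) /\
  (forall x : car A, aminus A x = aoplus A (aminus A x) (azero A)).

Definition SQMV_models (t s : term) : Prop :=
  forall A : alg, is_sqmvstar A ->
    forall v : nat -> car A, eval A v t = eval A v s.

Record Spt : Type := MkS {
  sa : R; sb : R;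
  sa_lo : -1 <= sa; sa_hi : sa <= 1;
  sb_lo : -1 <= sb; sb_hi : sb <= 1 }.

Definition clamp (x : R) : R := Rmax (-1) (Rmin 1 x).

Lemma clamp_lo x : -1 <= clamp x.
Proof. unfold clamp, Rmax, Rmin; repeat destruct Rle_dec; lra. Qed.
Lemma clamp_hi x : clamp x <= 1.
Proof. unfold clamp, Rmax, Rmin; repeat destruct Rle_dec; lra. Qed.
Lemma Rmax0_lo x : -1 <= Rmax 0 x.
Proof. unfold Rmax; destruct Rle_dec; lra. Qed.
Lemma Rmax0_hi x : x <= 1 -> Rmax 0 x <= 1.
Proof. unfold Rmax; destruct Rle_dec; lra. Qed.
Lemma Rmin0_lo x : -1 <= x -> -1 <= Rmin 0 x.
Proof. unfold Rmin; destruct Rle_dec; lra. Qed.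
Lemma Rmin0_hi x : Rmin 0 x <= 1.
Proof. unfold Rmin; destruct Rle_dec; lra. Qed.
Lemma m1_le0 : -1 <= 0. Proof. lra. Qed.
Lemma z_le1 : 0 <= 1. Proof. lra. Qed.
Lemma one_le1 : 1 <= 1. Proof. lra. Qed.
Lemma neg_lo x : x <= 1 -> -1 <= - x. Proof. lra. Qed.
Lemma neg_hi x : -1 <= x -> - x <= 1. Proof. lra. Qed.

Definition S_oplus (x y : Spt) : Spt :=
  MkS (clamp (sa x + sa y)) 0 (clamp_lo _) (clamp_hi _) m1_le0 z_le1.
Definition S_neg (x : Spt) : Spt :=
  MkS (- sa x) (- sb x) (neg_lo _ (sa_hi x)) (neg_hi _ (sa_lo x))
      (neg_lo _ (sb_hi x)) (neg_hi _ (sb_lo x)).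
Definition S_plus (x : Spt) : Spt :=
  MkS (Rmax 0 (sa x)) 0 (Rmax0_lo _) (Rmax0_hi _ (sa_hi x)) m1_le0 z_le1.
Definition S_minus (x : Spt) : Spt :=
  MkS (Rmin 0 (sa x)) 0 (Rmin0_lo _ (sa_lo x)) (Rmin0_hi _) m1_le0 z_le1.
Definition S_zero : Spt := MkS 0 0 m1_le0 z_le1 m1_le0 z_le1.
Definition S_one : Spt :=
  MkS 1 0 (Rle_trans _ _ _ m1_le0 z_le1) one_le1 m1_le0 z_le1.

Definition Sstar : alg := Alg Spt S_oplus S_neg S_plus S_minus S_zero S_one.

Definition Sstar_models (t s : term) : Prop :=
  forall v : nat -> Spt, eval Sstar v t = eval Sstar v s.

(* Main.v *)
(** An element of a strong quasi-MV* algebra with [x ⊕ 0 = x] is determined by the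
    positive parts of [x] and [- x], and the positive elements form an MV-algebra with
    negation [1 ⊕ - x]. A term that is not a variable under negations always takes such
    values, so an equation between two such terms amounts to two MV-equations, and Chang's
    completeness theorem reduces them to the real unit interval. Terms that are variables
    under negations are told apart in the square by its second coordinate.

    Chang's theorem: an ideal maximal among those avoiding a nonzero element is prime, so
    a failing MV-equation fails in a totally ordered MV-algebra. The latter is the unit
    interval of an ordered abelian group of pairs (integer part, fractional part). On the
    region selected by a valuation every term is an integer linear form, and a finite
    system of linear inequalities solvable in an ordered group is solvable in the reals
    by Fourier-Motzkin elimination. *)

From Stdlib Require Import Reals Lra Lia ZArith List Bool.
From Stdlib Require Import Classical ClassicalEpsilon FunctionalExtensionality.
From Stdlib Require Import PropExtensionality ProofIrrelevance.
From mathcomp Require classical_sets.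
Require Import Defs.
Import ListNotations.

(** * MV-algebras *)

Record mv : Type := MV {
  mcar :> Type;
  madd : mcar -> mcar -> mcar;
  mneg : mcar -> mcar;
  mzero : mcar;
  maddA : forall x y z, madd x (madd y z) = madd (madd x y) z;
  maddC : forall x y, madd x y = madd y x;
  madd0 : forall x, madd x mzero = x;
  mnegK : forall x, mneg (mneg x) = x;
  madd1 : forall x, madd x (mneg mzero) = mneg mzero;
  mluk : forall x y, madd (mneg (madd (mneg x) y)) y = madd (mneg (madd (mneg y) x)) x }.

Arguments madd {m}.
Arguments mneg {m}.
Arguments mzero {m}.

Declare Scope mv_scope.
Delimit Scope mv_scope with MV.
Notation "x ⊕ y" := (madd x y) (at level 50, left associativity) : mv_scope.
Notation "¬ x" := (mneg x) (at level 35, right associativity) : mv_scope.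
Notation "0" := mzero : mv_scope.
Notation "1" := (mneg mzero) : mv_scope.
Notation "x ⊖ y" := (mneg (madd (mneg x) y)) (at level 50, left associativity) : mv_scope.
Notation "x ⊙ y" := (mneg (madd (mneg x) (mneg y))) (at level 40, left associativity) : mv_scope.
Notation "x ≼ y" := (madd (mneg x) y = mneg mzero) (at level 70) : mv_scope.

Section MVTheory.

Variable M : mv.
Implicit Types a b c d e p q x y z : M.
Local Open Scope mv_scope.

Lemma madd0l x : 0 ⊕ x = x.
Proof. rewrite maddC. apply madd0. Qed.

Lemma madd1l x : 1 ⊕ x = 1.
Proof. rewrite maddC. apply madd1. Qed.

Lemma maddCA x y z : x ⊕ (y ⊕ z) = y ⊕ (x ⊕ z).
Proof. rewrite !maddA. f_equal. apply maddC. Qed.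

Lemma mle_refl x : x ≼ x.
Proof.
  pose proof (mluk M x 1) as H.
  rewrite madd1, mnegK, madd0l in H. symmetry. exact H.
Qed.

Lemma maddN x : x ⊕ ¬x = 1.
Proof. rewrite maddC. apply mle_refl. Qed.

Lemma mle_antisym x y : x ≼ y -> y ≼ x -> x = y.
Proof.
  intros H1 H2. pose proof (mluk M x y) as H.
  rewrite H1, H2, mnegK, !madd0l in H. congruence.
Qed.

Lemma msubK x y : x ≼ y -> (y ⊖ x) ⊕ x = y.
Proof. intros H. rewrite mluk, H, mnegK. apply madd0l. Qed.

Lemma mle_addr x y : x ≼ x ⊕ y.
Proof. rewrite maddA, (mle_refl x). apply madd1l. Qed.

Lemma mle_ex x y : x ≼ y -> exists z, y = x ⊕ z.
Proof. intros H. exists (y ⊖ x). now rewrite maddC, msubK. Qed.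

Lemma mle_trans y x z : x ≼ y -> y ≼ z -> x ≼ z.
Proof.
  intros [u ->]%mle_ex [w ->]%mle_ex. rewrite <- maddA. apply mle_addr.
Qed.

Lemma mle_add x y z : x ≼ y -> x ⊕ z ≼ y ⊕ z.
Proof.
  intros [w ->]%mle_ex. rewrite <- (maddA _ x), (maddC _ w), (maddA _ x z w). apply mle_addr.
Qed.

Lemma mle_addl x y z : x ≼ y -> z ⊕ x ≼ z ⊕ y.
Proof. intros H. rewrite !(maddC _ z). now apply mle_add. Qed.

Lemma mle_neg x y : x ≼ y -> ¬y ≼ ¬x.
Proof. intros H. rewrite mnegK, maddC. exact H. Qed.

Lemma mle0 x : 0 ≼ x.
Proof. apply madd1l. Qed.

Lemma mle0_eq x : x ≼ 0 -> x = 0.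
Proof. intros H. apply mle_antisym; [exact H | apply mle0]. Qed.

Lemma mle_eq1 x y : x = 1 -> x ≼ y -> y = 1.
Proof. intros ->. now rewrite mnegK, madd0l. Qed.

Lemma mle_sub x y z : x ⊖ y ≼ z <-> x ≼ y ⊕ z.
Proof. rewrite mnegK, maddA. reflexivity. Qed.

Lemma msub_eq0 x y : x ⊖ y = 0 <-> x ≼ y.
Proof.
  split; intros H.
  - rewrite <- (mnegK M (¬x ⊕ y)). now rewrite H.
  - rewrite H. apply mnegK.
Qed.

Lemma msub_le x y : x ⊖ y ≼ x.
Proof. apply mle_sub. rewrite (maddC _ y x). apply mle_addr. Qed.

Lemma mle_add_sub x y : x ≼ y ⊕ (x ⊖ y).
Proof. apply mle_sub, mle_refl. Qed.

Lemma mmul_le x y : x ⊙ y ≼ y.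
Proof. rewrite (maddC _ (¬x)). apply msub_le. Qed.

Lemma mmul_mono x y z : y ≼ z -> x ⊙ y ≼ x ⊙ z.
Proof. intros H. now apply mle_neg, mle_addl, mle_neg. Qed.

Lemma mmulA x y z : x ⊙ (y ⊙ z) = (x ⊙ y) ⊙ z.
Proof. now rewrite !mnegK, maddA. Qed.

(** The hypothesis says that [x ⊕ d] is not truncated. The Łukasiewicz law [mluk], applied to [¬x]
    and [d], then leaves only [¬¬x]. *)
Lemma maddK x d : x ≼ ¬d -> (x ⊕ d) ⊖ d = x.
Proof.
  intros H. rewrite <- (mnegK M x) at 1. rewrite mluk.
  rewrite (maddC _ (¬d)), H, mnegK, madd0l. apply mnegK.
Qed.

(** Both sides equal [(p ⊖ c) ⊕ c ⊕ (q ⊖ c)]. This and the following exchange laws provide the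
    associativity of addition with carry. *)
Lemma madd_sub_swap c p q : c ≼ p -> c ≼ q -> p ⊕ (q ⊖ c) = q ⊕ (p ⊖ c).
Proof.
  intros Hp Hq.
  rewrite <- (msubK c p Hp) at 1. rewrite <- (msubK c q Hq) at 2.
  rewrite <- !maddA, (maddC _ c), (maddC _ c). apply maddCA.
Qed.

Lemma msub_telescope c d e : d ≼ c -> c ≼ e -> (e ⊖ c) ⊕ (c ⊖ d) = e ⊖ d.
Proof.
  intros Hdc Hce.
  rewrite <- (maddK ((e ⊖ c) ⊕ (c ⊖ d)) d).
  - now rewrite <- maddA, (msubK _ _ Hdc), (msubK _ _ Hce).
  (* Cancelling [d] requires that adding it causes no overflow. Since [e ⊖ c ≼ ¬c], the sum is
     bounded by [¬c ⊕ (c ⊖ d)], which is [¬d]. *)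
  - apply mle_trans with (¬c ⊕ (c ⊖ d)).
    + apply mle_add, mle_neg. rewrite (maddC _ (¬e)). apply mle_addr.
    + pose proof (mluk M (¬d) (¬c)) as H.
      rewrite !mnegK, (maddC _ c), Hdc, mnegK, madd0l in H.
      rewrite (maddC _ (¬c)), (maddC _ (¬c) d), H. apply mle_refl.
Qed.

Lemma mmul_add_swap a b c : c ≼ ¬a -> c ≼ ¬b -> a ⊙ (b ⊕ c) = b ⊙ (a ⊕ c).
Proof.
  intros Ha Hb. f_equal.
  pose proof (madd_sub_swap c (¬a) (¬b) Ha Hb) as H. now rewrite !mnegK in H.
Qed.

Lemma madd_mul_swap a b c : ¬c ≼ a -> ¬c ≼ b -> a ⊕ (b ⊙ c) = b ⊕ (a ⊙ c).
Proof. apply madd_sub_swap. Qed.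

Lemma mmul_add_assoc a b c : c ≼ ¬b -> ¬c ≼ a -> a ⊙ (b ⊕ c) = b ⊕ (a ⊙ c).
Proof.
  intros Hb Ha.
  assert (Hd : a ⊙ c ≼ c) by apply mmul_le.
  pose proof (msub_telescope c (a ⊙ c) (¬b) Hd Hb) as H.
  rewrite mnegK in H.
  rewrite (maddC _ (¬c)), (msubK (¬c) a Ha), maddC in H.
  rewrite H. apply mnegK.
Qed.

(** [x ⊖ (x ⊖ y)] is the MV-form of the lattice meet; this is the half of its universal property
    that makes it the greatest lower bound. *)
Lemma mle_meet x y z : z ≼ x -> z ≼ y -> z ≼ x ⊖ (x ⊖ y).
Proof.
  intros Hx Hy. rewrite <- (mnegK M z). apply mle_neg.
  pose proof (msubK _ _ (mle_neg _ _ Hx)) as H. rewrite <- H.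
  rewrite (maddC _ (¬z ⊖ ¬x)). apply mle_addl, mle_neg.
  rewrite mnegK, (maddC _ z). now apply mle_addl.
Qed.

(** Says that the lattice meet of [a] and [b] is [0], without mentioning the meet. *)
Definition mdisj a b : Prop := forall d, d ≼ a -> d ≼ b -> d = 0.

Lemma mdisj_sym a b : mdisj a b -> mdisj b a.
Proof. intros H d Ha Hb. now apply H. Qed.

(** If [d] is below [a] and [b ⊕ c], then [d ⊖ b] is below [a] and [c], hence is [0]; so [d] is
    below [b] as well. *)
Lemma mdisj_add a b c : mdisj a b -> mdisj a c -> mdisj a (b ⊕ c).
Proof.
  intros Hb Hc d Hda Hd. apply Hb; [exact Hda|].
  apply msub_eq0, Hc.
  - apply mle_trans with d; [apply msub_le | exact Hda].
  - now apply mle_sub.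
Qed.

(* Both [x] and [y] exceed their meet [x ⊖ (x ⊖ y)] by the respective difference. *)
Lemma mdisj_sub x y : mdisj (x ⊖ y) (y ⊖ x).
Proof.
  intros d Ha Hb.
  set (w := x ⊖ (x ⊖ y)).
  assert (Hw : w = y ⊖ (y ⊖ x)).
  { unfold w. f_equal. rewrite (maddC _ (¬x)), (maddC _ (¬y)).
    pose proof (mluk M (¬x) (¬y)) as H. rewrite !mnegK in H.
    now rewrite (maddC _ x), (maddC _ y) in H. }
  assert (Hx : d ⊕ w ≼ x).
  { rewrite <- (msubK (x ⊖ y) x (msub_le x y)). fold w.
    rewrite (maddC _ w). now apply mle_add. }
  assert (Hy : d ⊕ w ≼ y).
  { rewrite <- (msubK (y ⊖ x) y (msub_le y x)). rewrite <- Hw.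
    rewrite (maddC _ w). now apply mle_add. }
  assert (Hdw : d ≼ ¬w).
  { apply mle_trans with (x ⊖ y); [exact Ha|].
    unfold w. rewrite (mnegK M (¬x ⊕ (x ⊖ y))).
    rewrite maddCA, mle_refl. apply madd1. }
  rewrite <- (maddK d w Hdw). apply msub_eq0. now apply mle_meet.
Qed.

End MVTheory.

(** * Totally ordered MV-algebras as unit intervals of ordered groups *)

Record oag : Type := OAG {
  gcar :> Type;
  gadd : gcar -> gcar -> gcar;
  gopp : gcar -> gcar;
  gzero : gcar;
  gle : gcar -> gcar -> Prop;
  gaddA : forall x y z, gadd x (gadd y z) = gadd (gadd x y) z;
  gaddC : forall x y, gadd x y = gadd y x;
  gadd0 : forall x, gadd x gzero = x;
  gaddN : forall x, gadd x (gopp x) = gzero;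
  gle_total : forall x y, gle x y \/ gle y x;
  gle_antisym : forall x y, gle x y -> gle y x -> x = y;
  gle_trans : forall x y z, gle x y -> gle y z -> gle x z;
  gle_add : forall x y z, gle x y -> gle (gadd z x) (gadd z y) }.

Arguments gadd {o}.
Arguments gopp {o}.
Arguments gzero {o}.
Arguments gle {o}.

Section Chain.

Variable M : mv.
Local Open Scope mv_scope.
Hypothesis mtotal : forall x y : M, x ≼ y \/ y ≼ x.
Hypothesis mnontriv : (0 : M) <> 1.
Implicit Types a b c : M.

(* The pair [(m, a)] stands for [m u + a], where [u] is the unit; it is
   normalised by [a <> 1]. *)
Definition carry_add a (s : Z * M) : Z * M :=
  if excluded_middle_informative (a ⊕ snd s = 1)
  then ((fst s + 1)%Z, a ⊙ snd s) else (fst s, a ⊕ snd s).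

Lemma carry_add_norm a s : snd s <> 1 -> snd (carry_add a s) <> 1.
Proof.
  intros Hs. unfold carry_add.
  destruct (excluded_middle_informative _) as [H|H]; simpl; [|exact H].
  intros E. apply Hs, (mle_eq1 _ _ _ E), mmul_le.
Qed.

Lemma not_carry_le a c : a ⊕ c <> 1 -> c ≼ ¬a.
Proof.
  intros H. destruct (mtotal c (¬a)) as [H'|H']; [exact H'|].
  now rewrite mnegK in H'.
Qed.

Lemma carry_le a c : a ⊕ c = 1 -> ¬c ≼ a.
Proof. intros H. now rewrite mnegK, maddC. Qed.

(** Associativity of the group rests on this commutation. The cases record which of [a] and [b]
    overflows when added to the fractional part of [s]; each has its own exchange law. *)
Lemma carry_add_comm a b s : carry_add a (carry_add b s) = carry_add b (carry_add a s).
Proof.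
  (* The mixed case: exactly one carry occurs on each side. A second carry on the right would force
     [y ⊕ snd s = 1], because [x ⊙ (y ⊕ snd s)] is below [y ⊕ snd s]. *)
  assert (aux : forall x y, x ⊕ snd s = 1 -> y ⊕ snd s <> 1 ->
            carry_add x (carry_add y s) = carry_add y (carry_add x s)).
  { intros x y Hx Hy. unfold carry_add at 2 4.
    destruct (excluded_middle_informative (x ⊕ snd s = 1)) as [_|n]; [|easy].
    destruct (excluded_middle_informative (y ⊕ snd s = 1)) as [n|_]; [easy|].
    unfold carry_add; simpl.
    rewrite (maddCA _ x y), Hx, madd1.
    destruct (excluded_middle_informative (1 = 1)) as [_|n]; [|easy].
    rewrite <- (mmul_add_assoc _ x y (snd s)).
    - destruct (excluded_middle_informative _) as [E|_]; [exfalso|easy].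
      now apply Hy, (mle_eq1 _ _ _ E), mmul_le.
    - now apply not_carry_le.
    - now apply carry_le. }
  destruct (excluded_middle_informative (a ⊕ snd s = 1)) as [Ha|Ha];
    destruct (excluded_middle_informative (b ⊕ snd s = 1)) as [Hb|Hb].
  - unfold carry_add at 2 4.
    destruct (excluded_middle_informative (b ⊕ snd s = 1)) as [_|n]; [|easy].
    destruct (excluded_middle_informative (a ⊕ snd s = 1)) as [_|n]; [|easy].
    unfold carry_add; simpl.
    rewrite (madd_mul_swap _ a b (snd s)) by now apply carry_le.
    rewrite !mmulA, (maddC _ (¬a) (¬b)). reflexivity.
  - now apply aux.
  - symmetry. now apply aux.
  - unfold carry_add at 2 4.
    destruct (excluded_middle_informative (b ⊕ snd s = 1)) as [n|_]; [easy|].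
    destruct (excluded_middle_informative (a ⊕ snd s = 1)) as [n|_]; [easy|].
    unfold carry_add; simpl.
    rewrite (maddCA _ a b).
    rewrite (mmul_add_swap _ a b (snd s)) by now apply not_carry_le.
    reflexivity.
Qed.

Definition chain_car : Type := {s : Z * M | snd s <> 1}.

Lemma chain_ext (x y : chain_car) : proj1_sig x = proj1_sig y -> x = y.
Proof. apply eq_sig_hprop. intros; apply proof_irrelevance. Qed.

Definition pair_add (s t : Z * M) : Z * M :=
  let r := carry_add (snd s) t in ((fst s + fst r)%Z, snd r).

Lemma carry_add_shift a m n c :
  carry_add a ((m + n)%Z, c) =
  ((m + fst (carry_add a (n, c)))%Z, snd (carry_add a (n, c))).
Proof.
  unfold carry_add; simpl. destruct (excluded_middle_informative _); simpl; f_equal; lia.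
Qed.

Lemma pair_addC s t : pair_add s t = pair_add t s.
Proof.
  destruct s as [m a], t as [n b]. unfold pair_add, carry_add; simpl.
  rewrite (maddC _ b a), (maddC _ (¬b) (¬a)).
  destruct (excluded_middle_informative _); simpl; f_equal; lia.
Qed.

Lemma pair_addCA s t r : pair_add s (pair_add t r) = pair_add t (pair_add s r).
Proof.
  destruct s as [m a], t as [n b], r as [k c]. unfold pair_add; simpl.
  pose proof (carry_add_comm a b (k, c)) as H.
  destruct (carry_add b (k, c)) as [k1 c1], (carry_add a (k, c)) as [k2 c2]; simpl.
  rewrite !carry_add_shift, H; simpl. f_equal. lia.
Qed.

Lemma pair_addA s t r : pair_add s (pair_add t r) = pair_add (pair_add s t) r.
Proof. now rewrite (pair_addC t r), pair_addCA, pair_addC. Qed.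

Definition pair_le (s t : Z * M) : Prop :=
  (fst s < fst t)%Z \/ fst s = fst t /\ snd s ≼ snd t.

Lemma carry_add_mono a s t : pair_le s t -> pair_le (carry_add a s) (carry_add a t).
Proof.
  destruct s as [m c], t as [n d]. unfold pair_le, carry_add; simpl.
  intros [H|[-> H]];
  destruct (excluded_middle_informative (a ⊕ c = 1)) as [Hc|Hc];
    destruct (excluded_middle_informative (a ⊕ d = 1)) as [Hd|Hd]; simpl; try lia.
  (* Only the smaller pair carries. If its integer part thereby catches up, the fractional parts
     still compare: [a ⊙ c ≼ a ≼ a ⊕ d]. *)
  - destruct (Z.eq_dec (m + 1) n) as [E|E]; [right|lia].
    split; [exact E|]. apply mle_trans with a; [apply msub_le|apply mle_addr].
  - right. split; [easy|]. now apply mmul_mono.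
  - exfalso. now apply Hd, (mle_eq1 _ _ _ Hc), mle_addl.
  - right. split; [easy|]. now apply mle_addl.
Qed.

Definition chain_add (x y : chain_car) : chain_car :=
  exist _ (pair_add (proj1_sig x) (proj1_sig y))
    (carry_add_norm (snd (proj1_sig x)) _ (proj2_sig y)).

Definition chain_pt (m : Z) (a : M) (Ha : a <> 1) : chain_car := exist _ (m, a) Ha.

Definition chain_zero : chain_car := chain_pt 0 0 mnontriv.

Lemma neg_neq1 a : a <> 0 -> ¬a <> 1.
Proof. intros H E. apply H. now rewrite <- (mnegK M a), E, mnegK. Qed.

(** In general [-(m u + a) = (-m - 1) u + ¬a]. For [a = 0] the fractional part [¬a] would be [1],
    which the normalisation excludes. *)
Definition chain_opp (x : chain_car) : chain_car :=
  match excluded_middle_informative (snd (proj1_sig x) = 0) with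
  | left _ => chain_pt (- fst (proj1_sig x)) 0 mnontriv
  | right H => chain_pt (- fst (proj1_sig x) - 1) (¬ snd (proj1_sig x)) (neg_neq1 _ H)
  end.

Lemma chain_addN x : chain_add x (chain_opp x) = chain_zero.
Proof.
  apply chain_ext. destruct x as [[m a] Ha]. unfold chain_opp; simpl in *.
  destruct (excluded_middle_informative (a = 0)) as [E|E]; simpl;
    unfold pair_add, carry_add; simpl.
  - subst a. rewrite madd0.
    destruct (excluded_middle_informative _) as [n|_]; [easy|]. simpl. f_equal. lia.
  - rewrite maddN. destruct (excluded_middle_informative _) as [_|n]; [|easy].
    simpl. rewrite maddN, mnegK. f_equal. lia.
Qed.

Lemma chain_add0 x : chain_add x chain_zero = x.
Proof.
  apply chain_ext. destruct x as [[m a] Ha]. simpl.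
  unfold pair_add, carry_add; simpl in *. rewrite madd0.
  destruct (excluded_middle_informative _) as [n|_]; [easy|]. simpl. f_equal. lia.
Qed.

Definition chain_le (x y : chain_car) : Prop := pair_le (proj1_sig x) (proj1_sig y).

Definition chain_group : oag.
Proof.
  refine (OAG chain_car chain_add chain_opp chain_zero chain_le _ _
            chain_add0 chain_addN _ _ _ _).
  - intros x y z. apply chain_ext, pair_addA.
  - intros x y. apply chain_ext, pair_addC.
  - intros [[m a] Ha] [[n b] Hb]. unfold chain_le, pair_le; simpl.
    destruct (Z.lt_total m n) as [H|[H|H]]; auto.
    destruct (mtotal a b); auto.
  - intros x y H1 H2. apply chain_ext. unfold chain_le, pair_le in *.
    destruct x as [[m a] Ha], y as [[n b] Hb]; simpl in *.
    destruct H1 as [H1|[E H1]], H2 as [H2|[E2 H2]]; try lia.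
    f_equal; [exact E | now apply mle_antisym].
  - intros [[m a] Ha] [[n b] Hb] [[k c] Hc]. unfold chain_le, pair_le; simpl.
    intros [H1|[E1 H1]] [H2|[E2 H2]]; try lia.
    right. split; [lia|]. now apply mle_trans with b.
  - intros x y z H. unfold chain_le in *; simpl.
    apply (carry_add_mono (snd (proj1_sig z))) in H.
    unfold pair_add, pair_le in *; simpl.
    destruct H as [H|[E H]]; [left|right; split; [|exact H]]; lia.
Defined.

Definition chain_unit : chain_group := chain_pt 1 0 mnontriv.

(** The element [1] is not a normalised fractional part, so it is represented by the unit
    [(1, 0)]. *)
Definition chain_emb (a : M) : chain_group :=
  match excluded_middle_informative (a = 1) with
  | left _ => chain_unit
  | right H => chain_pt 0 a H
  end.

Lemma chain_emb_val a : a <> 1 -> proj1_sig (chain_emb a) = (0%Z, a).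
Proof. intros H. unfold chain_emb. now destruct (excluded_middle_informative _). Qed.

Lemma chain_emb0 : chain_emb 0 = gzero.
Proof.
  unfold chain_emb. destruct (excluded_middle_informative _) as [n|n]; [easy|].
  now apply chain_ext.
Qed.

Lemma chain_emb1 : chain_emb 1 = chain_unit.
Proof. unfold chain_emb. now destruct (excluded_middle_informative _). Qed.

Lemma chain_emb_ge0 a : gle gzero (chain_emb a).
Proof.
  unfold chain_emb. destruct (excluded_middle_informative _); simpl.
  - left. simpl. lia.
  - right. simpl. split; [easy|apply mle0].
Qed.

Lemma chain_emb_le1 a : gle (chain_emb a) chain_unit.
Proof.
  unfold chain_emb. destruct (excluded_middle_informative _); simpl.
  - right. simpl. split; [easy|apply mle_refl].
  - left. simpl. lia.
Qed.

Lemma chain_emb_inj a b : chain_emb a = chain_emb b -> a = b.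
Proof.
  unfold chain_emb.
  destruct (excluded_middle_informative (a = 1)), (excluded_middle_informative (b = 1));
    intros H; try congruence; apply (f_equal (@proj1_sig _ _)) in H; simpl in H; congruence.
Qed.

Lemma chain_unit_nle0 : ~ gle chain_unit (gzero : chain_group).
Proof. intros [H|[H _]]; simpl in H; lia. Qed.

Lemma chain_emb_neg a : gadd (chain_emb a) (chain_emb (¬a)) = chain_unit.
Proof.
  unfold chain_emb at 1. destruct (excluded_middle_informative (a = 1)) as [->|Ha].
  - rewrite mnegK, chain_emb0. apply gadd0.
  - unfold chain_emb. destruct (excluded_middle_informative (¬a = 1)) as [E|E];
      apply chain_ext; simpl; unfold pair_add, carry_add; simpl.
    + assert (a = 0) as -> by now rewrite <- (mnegK M a), E, mnegK.
      rewrite madd0. destruct (excluded_middle_informative _) as [n|_]; easy.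
    + rewrite maddN. destruct (excluded_middle_informative _) as [_|n]; [|easy].
      simpl. now rewrite maddN, mnegK.
Qed.

(** The two cases of [min(u, a + b)], each with the group inequality that selects it. These
    inequalities later become the linear constraints of a region. *)
Lemma chain_emb_add a b :
  (a ⊕ b = 1 /\ gle chain_unit (gadd (chain_emb a) (chain_emb b))) \/
  (chain_emb (a ⊕ b) = gadd (chain_emb a) (chain_emb b) /\
   gle (gadd (chain_emb a) (chain_emb b)) chain_unit).
Proof.
  destruct (classic (a = 1)) as [->|Ha]; [left|].
  { split; [apply madd1l|]. rewrite chain_emb1.
    rewrite <- (gadd0 _ chain_unit) at 1. apply gle_add, chain_emb_ge0. }
  destruct (classic (b = 1)) as [->|Hb]; [left|].
  { split; [apply madd1|]. rewrite chain_emb1, gaddC.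
    rewrite <- (gadd0 _ chain_unit) at 1. apply gle_add, chain_emb_ge0. }
  assert (Hs : proj1_sig (gadd (chain_emb a) (chain_emb b)) = carry_add a (0%Z, b)).
  { simpl. rewrite !chain_emb_val by assumption. unfold pair_add; simpl.
    now destruct (carry_add a (0%Z, b)). }
  revert Hs. generalize (gadd (chain_emb a) (chain_emb b)). intros g Hs.
  unfold carry_add in Hs; simpl in Hs.
  destruct (excluded_middle_informative (a ⊕ b = 1)) as [E|E]; [left|right].
  - split; [exact E|]. right. rewrite Hs. split; [easy|]. apply mle0.
  - split; [|left; rewrite Hs; simpl; lia].
    apply chain_ext. now rewrite Hs, chain_emb_val.
Qed.

End Chain.

(** * Fourier-Motzkin elimination *)

Fixpoint lin (n : nat) (f : nat -> Z) (x : nat -> R) : R :=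
  match n with
  | O => 0
  | S k => lin k f x + IZR (f k) * x k
  end.

Definition sat (strict : bool) (r : R) : Prop := if strict then 0 < r else 0 <= r.

Lemma lin_ext n f g x y : (forall i, (i < n)%nat -> IZR (f i) * x i = IZR (g i) * y i) ->
  lin n f x = lin n g y.
Proof.
  induction n as [|n IH]; simpl; intros H; [easy|].
  rewrite (H n) by lia. f_equal. apply IH. intros i Hi. apply H. lia.
Qed.

Lemma lin_comb n (a b : Z) f g x :
  lin n (fun i => a * f i + b * g i)%Z x = IZR a * lin n f x + IZR b * lin n g x.
Proof.
  induction n as [|n IH]; simpl; [ring|].
  rewrite IH, plus_IZR, !mult_IZR. ring.
Qed.

Lemma lin_add n f g x : lin n (fun i => f i + g i)%Z x = lin n f x + lin n g x.
Proof.
  induction n as [|n IH]; simpl; [ring|]. rewrite IH, plus_IZR. ring.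
Qed.

Lemma lin_opp n f x : lin n (fun i => - f i)%Z x = - lin n f x.
Proof.
  induction n as [|n IH]; simpl; [ring|]. rewrite IH, opp_IZR. ring.
Qed.

Lemma lin_scale n f x k : lin n f (fun i => k * x i) = k * lin n f x.
Proof. induction n as [|n IH]; simpl; [ring|]. rewrite IH. ring. Qed.

Definition basis (k : nat) : nat -> Z := fun i => if Nat.eqb i k then 1%Z else 0%Z.

Lemma lin_basis n k x : (k < n)%nat -> lin n (basis k) x = x k.
Proof.
  assert (Z0 : forall m, (m <= k)%nat -> lin m (basis k) x = 0).
  { induction m as [|m IH]; simpl; intros H; [easy|].
    rewrite IH by lia. unfold basis. destruct (Nat.eqb_spec m k); [lia|]. ring. }
  induction n as [|n IH]; simpl; intros H; [lia|].
  unfold basis at 2. destruct (Nat.eqb_spec n k) as [->|E].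
  - rewrite Z0 by lia. ring.
  - rewrite IH by lia. ring.
Qed.

Lemma list_max (l : list (bool * R)) : l <> nil ->
  exists m, In m l /\ forall c, In c l -> snd c <= snd m.
Proof.
  induction l as [|a l IH]; [easy|]. intros _.
  destruct l as [|b l'].
  - exists a. split; [now left|]. intros c [<-|[]]. lra.
  - destruct IH as [m [Hm H]]; [easy|].
    destruct (Rle_dec (snd a) (snd m)) as [L|L].
    + exists m. split; [now right|]. intros c [<-|Hc]; auto.
    + exists a. split; [now left|]. intros c [<-|Hc]; [lra|]. specialize (H c Hc). lra.
Qed.

Definition rlt (strict : bool) (x y : R) : Prop := if strict then x < y else x <= y.

Lemma list_min (l : list (bool * R)) : l <> nil ->
  exists m, In m l /\ forall c, In c l -> snd m <= snd c.
Proof.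
  intros Hl. destruct (list_max (map (fun c => (fst c, - snd c)) l)) as [m [Hm H]].
  - now destruct l.
  - apply in_map_iff in Hm. destruct Hm as [c [<- Hc]]. exists c. split; [easy|].
    intros d Hd. specialize (H (fst d, - snd d) (in_map _ _ _ Hd)). simpl in H. lra.
Qed.

(** If both lists are nonempty, the midpoint of the greatest lower bound [r1] and the least upper
    bound [r2] works. A strict lower bound [r] satisfies [r <= r1] and [r < r2], so it is strictly
    below the midpoint; upper bounds are dual. *)
Lemma point_between (lo up : list (bool * R)) :
  (forall b r b' r', In (b, r) lo -> In (b', r') up -> rlt (b || b') r r') ->
  exists t, (forall b r, In (b, r) lo -> rlt b r t) /\
            (forall b r, In (b, r) up -> rlt b t r).
Proof.
  intros H.
  assert (W : forall b r s, r < s -> rlt b r s) by (intros []; simpl; intros; lra).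
  destruct (classic (lo = nil)) as [->|Hlo]; destruct (classic (up = nil)) as [->|Hup].
  - exists 0. split; intros b r [].
  - destruct (list_min up Hup) as [m [_ Hm]]. exists (snd m - 1).
    split; [intros b r []|]. intros b r Hb. apply W.
    specialize (Hm _ Hb). simpl in Hm. lra.
  - destruct (list_max lo Hlo) as [m [_ Hm]]. exists (snd m + 1).
    split; [|intros b r []]. intros b r Hb. apply W.
    specialize (Hm _ Hb). simpl in Hm. lra.
  - destruct (list_max lo Hlo) as [[b1 r1] [H1 M1]].
    destruct (list_min up Hup) as [[b2 r2] [H2 M2]]. simpl in *.
    exists ((r1 + r2) / 2).
    pose proof (H _ _ _ _ H1 H2) as H12.
    assert (L12 : r1 <= r2) by (destruct (b1 || b2); simpl in H12; lra).
    split; intros b r Hb.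
    + pose proof (M1 _ Hb) as L. simpl in L.
      pose proof (H _ _ _ _ Hb H2) as L'.
      destruct b; simpl in *; [lra|lra].
    + pose proof (M2 _ Hb) as L. simpl in L.
      pose proof (H _ _ _ _ H1 Hb) as L'.
      destruct b; [rewrite orb_true_r in L'|]; simpl in *; lra.
Qed.

(** One Fourier-Motzkin step: variable [n] cancels in each combination of a row with positive and a
    row with negative coefficient. A combination is strict as soon as one of its rows is. *)
Definition elim_pairs (n : nat) (l : list (bool * (nat -> Z))) : list (bool * (nat -> Z)) :=
  flat_map (fun c =>
    if (snd c n =? 0)%Z then [c] else
    if (snd c n <? 0)%Z then [] else
    flat_map (fun d =>
      if (snd d n <? 0)%Z
      then [(fst c || fst d, fun i => - snd d n * snd c i + snd c n * snd d i)%Z]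
      else []) l) l.

Section Cone.

Variable cone : bool -> (nat -> Z) -> Prop.
Hypothesis cone_add : forall b f b' g, cone b f -> cone b' g ->
  cone (b || b') (fun i => f i + g i)%Z.

(** Only closure under sums is assumed of [cone], so a positive integer multiple is built as a
    repeated sum. *)
Lemma cone_scale b f k : (0 < k)%Z -> cone b f -> cone b (fun i => k * f i)%Z.
Proof.
  intros Hk Hf. replace k with (Z.of_nat (S (Z.to_nat (k - 1)))) by lia.
  clear Hk. induction (Z.to_nat (k - 1)) as [|m IH].
  - replace (fun i => (Z.of_nat 1 * f i)%Z) with f; [easy|].
    apply functional_extensionality; intros i. lia.
  - pose proof (cone_add _ _ _ _ Hf IH) as H. rewrite orb_diag in H.
    replace (fun i => (Z.of_nat (S (S m)) * f i)%Z)
      with (fun i => (f i + Z.of_nat (S m) * f i)%Z); [easy|].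
    apply functional_extensionality; intros i. lia.
Qed.

Lemma cone_elim_pairs n l : (forall b f, In (b, f) l -> cone b f) ->
  forall b f, In (b, f) (elim_pairs n l) -> cone b f /\ f n = 0%Z.
Proof.
  intros Hl b f H. apply in_flat_map in H. destruct H as [[b1 f1] [H1 H]]. simpl in H.
  destruct (Z.eqb_spec (f1 n) 0) as [E|E].
  - destruct H as [H|[]]. inversion H; subst. auto.
  - destruct (Z.ltb_spec (f1 n) 0) as [N|N]; [easy|].
    apply in_flat_map in H. destruct H as [[b2 f2] [H2 H]]. simpl in H.
    destruct (Z.ltb_spec (f2 n) 0) as [N'|N']; [|easy].
    destruct H as [H|[]]. inversion H; subst. split; [|lia].
    apply cone_add; apply cone_scale; auto; lia.
Qed.

End Cone.

(** [cone] abstracts the set of inequalities true at a point of an ordered group; consistency means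
    that it does not contain [0 < 0]. The induction passes to the members of the cone free of
    variable [n], which include the eliminated system, and then extends its real solution by one
    coordinate. *)
Lemma motzkin n : forall cone : bool -> (nat -> Z) -> Prop,
  (forall b f b' g, cone b f -> cone b' g -> cone (b || b') (fun i => f i + g i)%Z) ->
  (forall f, (forall i, (i < n)%nat -> f i = 0%Z) -> ~ cone true f) ->
  forall l, (forall b f, In (b, f) l -> cone b f) ->
  exists x, forall b f, In (b, f) l -> sat b (lin n f x).
Proof.
  induction n as [|n IH]; intros cone Hadd Hcons l Hl.
  - exists (fun _ => 0). intros [] f Hf; simpl; [|lra].
    exfalso. apply (Hcons f); [lia|auto].
  - destruct (IH (fun b f => cone b f /\ f n = 0%Z)) with (l := elim_pairs n l)
      as [x Hx].
    + intros b f b' g [Hf Ef] [Hg Eg]. split; [auto|lia].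
    + intros f Hf [Hc E]. apply (Hcons f); [|easy].
      intros i Hi. destruct (Nat.eq_dec i n) as [->|D]; [easy|]. apply Hf. lia.
    + now apply cone_elim_pairs.
    (* Rows with a positive coefficient at [n] bound the new coordinate from below, rows with a
       negative one from above. *)
    + destruct (point_between
        (map (fun c => (fst c, - lin n (snd c) x / IZR (snd c n)))
          (filter (fun c => 0 <? snd c n)%Z l))
        (map (fun c => (fst c, lin n (snd c) x / - IZR (snd c n)))
          (filter (fun c => snd c n <? 0)%Z l))) as [t [Hlo Hup]].
      { intros b r b' r' H1 H2.
        apply in_map_iff in H1. destruct H1 as [[b1 f] [E1 H1]].
        apply in_map_iff in H2. destruct H2 as [[b2 g] [E2 H2]].
        apply filter_In in H1. destruct H1 as [H1 P].
        apply filter_In in H2. destruct H2 as [H2 N]. simpl in *.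
        inversion E1; subst; clear E1. inversion E2; subst; clear E2.
        apply Z.ltb_lt in P. pose proof N as N0. apply Z.ltb_lt in N.
        assert (S : sat (b || b') (lin n (fun i => - g n * f i + f n * g i)%Z x)).
        { apply Hx. apply in_flat_map. exists (b, f). split; [easy|]. simpl.
          destruct (Z.eqb_spec (f n) 0); [lia|].
          destruct (Z.ltb_spec (f n) 0); [lia|].
          apply in_flat_map. exists (b', g). split; [easy|]. simpl. rewrite N0.
          now left. }
        rewrite lin_comb, opp_IZR in S.
        apply IZR_lt in P, N.
        set (F := lin n f x) in *. set (K := lin n g x) in *.
        (* The gap between upper and lower bound is the value of the combined row divided by a
           positive number. *)
        assert (E : K / - IZR (g n) - - F / IZR (f n) =
          (- IZR (g n) * F + IZR (f n) * K) * / (IZR (f n) * - IZR (g n))).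
        { field. lra. }
        assert (I : 0 < / (IZR (f n) * - IZR (g n))).
        { apply Rinv_0_lt_compat. nra. }
        destruct (b || b'); simpl in *.
        - pose proof (Rmult_lt_0_compat _ _ S I). lra.
        - pose proof (Rmult_le_pos _ _ S (Rlt_le _ _ I)). lra. }
      exists (fun i => if Nat.eqb i n then t else x i).
      intros b f Hf. simpl. rewrite Nat.eqb_refl.
      replace (lin n f (fun i => if Nat.eqb i n then t else x i)) with (lin n f x)
        by (apply lin_ext; intros i Hi; destruct (Nat.eqb_spec i n); [lia|easy]).
      destruct (Z.lt_total (f n) 0) as [N|[E|P]].
      * assert (B : rlt b t (lin n f x / - IZR (f n))).
        { apply Hup. apply in_map_iff. exists (b, f). split; [easy|].
          apply filter_In. split; [easy|]. now apply Z.ltb_lt. }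
        apply IZR_lt in N.
        assert (E : lin n f x + IZR (f n) * t =
                    - IZR (f n) * (lin n f x / - IZR (f n) - t)) by (field; lra).
        rewrite E. destruct b; simpl in *; nra.
      * rewrite E, Rmult_0_l, Rplus_0_r. apply Hx.
        apply in_flat_map. exists (b, f). split; [easy|]. simpl. rewrite E. now left.
      * assert (B : rlt b (- lin n f x / IZR (f n)) t).
        { apply Hlo. apply in_map_iff. exists (b, f). split; [easy|].
          apply filter_In. split; [easy|]. now apply Z.ltb_lt. }
        apply IZR_lt in P.
        assert (E : lin n f x + IZR (f n) * t =
                    IZR (f n) * (t - - lin n f x / IZR (f n))) by (field; lra).
        rewrite E. destruct b; simpl in *; nra.
Qed.

(** * Integer linear forms in an ordered abelian group *)

Section LinearForms.

Variable G : oag.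
Variable g : nat -> G.
Variable n : nat.

Lemma gadd0l (x : G) : gadd gzero x = x.
Proof. rewrite gaddC. apply gadd0. Qed.

Lemma gadd_cancel (x y z : G) : gadd x y = gadd x z -> y = z.
Proof.
  intros H. rewrite <- (gadd0l y), <- (gadd0l z), <- (gaddN _ x), (gaddC _ x).
  rewrite <- !gaddA. now rewrite H.
Qed.

Lemma gaddACA (x y z w : G) : gadd (gadd x y) (gadd z w) = gadd (gadd x z) (gadd y w).
Proof. rewrite !gaddA. f_equal. rewrite <- !gaddA. f_equal. apply gaddC. Qed.

Lemma gle_refl (x : G) : gle x x.
Proof. now destruct (gle_total _ x x). Qed.

Lemma gle_sub (x y : G) : gle x y <-> gle gzero (gadd y (gopp x)).
Proof.
  split; intros H.
  - apply (gle_add _ _ _ (gopp x)) in H. now rewrite !(gaddC _ (gopp x)), gaddN in H.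
  - apply (gle_add _ _ _ x) in H.
    now rewrite gadd0, (gaddC _ y), gaddA, gaddN, gadd0l in H.
Qed.

Lemma gsub_le0 (x y : G) : gle (gadd x (gopp y)) gzero -> gle x y.
Proof.
  intros H. apply (gle_add _ _ _ y) in H.
  now rewrite gadd0, (gaddC _ x), gaddA, gaddN, gadd0l in H.
Qed.

Lemma gadd_ge0 (x y : G) : gle gzero x -> gle gzero y -> gle gzero (gadd x y).
Proof.
  intros Hx Hy. apply gle_trans with x; [exact Hx|].
  rewrite <- (gadd0 _ x) at 1. now apply gle_add.
Qed.

Lemma gadd_gt0 (x y : G) : gle gzero x -> ~ gle y gzero -> ~ gle (gadd x y) gzero.
Proof.
  intros Hx Hy H. apply Hy. apply gle_trans with (gadd x y); [|exact H].
  rewrite <- (gadd0 _ y) at 1. rewrite (gaddC _ x). now apply gle_add.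
Qed.

Lemma ngle_ge (x y : G) : ~ gle x y -> gle y x.
Proof. intros H. destruct (gle_total _ x y); easy. Qed.

Fixpoint nmul (k : nat) (x : G) : G :=
  match k with
  | O => gzero
  | S j => gadd x (nmul j x)
  end.

Lemma nmul_add j k x : nmul (j + k) x = gadd (nmul j x) (nmul k x).
Proof.
  induction j as [|j IH]; simpl; [now rewrite gadd0l|]. now rewrite IH, gaddA.
Qed.

Fixpoint glin (m : nat) (p : nat -> nat) : G :=
  match m with
  | O => gzero
  | S k => gadd (glin k p) (nmul (p k) (g k))
  end.

Lemma glin_add m p q : glin m (fun i => p i + q i)%nat = gadd (glin m p) (glin m q).
Proof.
  induction m as [|m IH]; simpl; [now rewrite gadd0|].
  rewrite IH, nmul_add. apply gaddACA.
Qed.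

Lemma glin_ext m p q : (forall i, (i < m)%nat -> p i = q i) -> glin m p = glin m q.
Proof.
  induction m as [|m IH]; simpl; intros H; [easy|].
  rewrite (H m) by lia. f_equal. apply IH. intros i Hi. apply H. lia.
Qed.

(* [s] is the value at [g] of the integer linear form [f] in [n] variables; splitting
   [f] into two natural-number forms avoids integer multiples in [G]. *)
Definition rep (f : nat -> Z) (s : G) : Prop :=
  exists p q : nat -> nat, (forall i, f i = Z.of_nat (p i) - Z.of_nat (q i))%Z /\
    gadd (glin n q) s = glin n p.

Lemma rep_add f s f' s' : rep f s -> rep f' s' -> rep (fun i => f i + f' i)%Z (gadd s s').
Proof.
  intros [p [q [E H]]] [p' [q' [E' H']]].
  exists (fun i => p i + p' i)%nat, (fun i => q i + q' i)%nat. split.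
  - intros i. rewrite E, E'. lia.
  - now rewrite !glin_add, gaddACA, H, H'.
Qed.

Lemma rep_opp f s : rep f s -> rep (fun i => - f i)%Z (gopp s).
Proof.
  intros [p [q [E H]]]. exists q, p. split.
  - intros i. rewrite E. lia.
  - rewrite <- H, <- gaddA, gaddN. apply gadd0.
Qed.

Lemma rep_sub f s f' s' : rep f s -> rep f' s' ->
  rep (fun i => f i + - f' i)%Z (gadd s (gopp s')).
Proof. intros H H'. now apply rep_add, rep_opp. Qed.

Lemma rep_zero : rep (fun _ => 0%Z) gzero.
Proof. exists (fun _ => O), (fun _ => O). split; [easy|]. apply gadd0. Qed.

Lemma rep_basis k : (k < n)%nat -> rep (basis k) (g k).
Proof.
  intros Hk. exists (fun i => if Nat.eqb i k then 1%nat else O), (fun _ => O). split.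
  - intros i. unfold basis. now destruct (Nat.eqb i k).
  - assert (Z0 : forall m, glin m (fun _ => O) = gzero).
    { induction m as [|m IH]; simpl; [easy|]. now rewrite IH, gadd0. }
    rewrite Z0, gadd0l.
    assert (Z1 : forall m, (m <= k)%nat ->
              glin m (fun i => if Nat.eqb i k then 1%nat else O) = gzero).
    { intros m Hm. rewrite <- (Z0 m). apply glin_ext. intros i Hi.
      destruct (Nat.eqb_spec i k); lia. }
    induction n as [|m IH]; simpl; [lia|].
    destruct (Nat.eqb_spec m k) as [->|E].
    + rewrite Z1 by lia. simpl. now rewrite gadd0, gadd0l.
    + simpl. rewrite gadd0. apply IH. lia.
Qed.

Lemma rep_null f s : (forall i, (i < n)%nat -> f i = 0%Z) -> rep f s -> s = gzero.
Proof.
  intros Hf [p [q [E H]]]. apply (gadd_cancel (glin n q)).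
  rewrite H, gadd0. apply glin_ext. intros i Hi. specialize (Hf i Hi). specialize (E i). lia.
Qed.

(** The cone for [motzkin]: the inequalities that hold at the point [g]. As the order is total,
    [0 < s] can be expressed by [~ gle s gzero]. *)
Definition gcone (strict : bool) (f : nat -> Z) : Prop :=
  exists s, rep f s /\ if strict then ~ gle s gzero else gle gzero s.

Lemma gcone_add b f b' f' : gcone b f -> gcone b' f' ->
  gcone (b || b') (fun i => f i + f' i)%Z.
Proof.
  intros [s [Hs P]] [s' [Hs' P']]. exists (gadd s s'). split; [now apply rep_add|].
  destruct b, b'; simpl.
  - apply gadd_gt0; [now apply ngle_ge|easy].
  - rewrite gaddC. now apply gadd_gt0.
  - now apply gadd_gt0.
  - now apply gadd_ge0.
Qed.

(** Transfer from the group to the reals. The cone is consistent because a form with vanishing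
    coefficients takes the value [0] at [g]. *)
Lemma gcone_solvable l : (forall b f, In (b, f) l -> gcone b f) ->
  exists x, forall b f, In (b, f) l -> sat b (lin n f x).
Proof.
  apply motzkin; [exact gcone_add|].
  intros f Hf [s [Hs P]]. apply P. rewrite (rep_null _ _ Hf Hs). apply gle_refl.
Qed.

End LinearForms.

(** * Chang's completeness theorem *)

Inductive mterm : Type :=
  | mvar : nat -> mterm
  | mO : mterm
  | mN : mterm -> mterm
  | mA : mterm -> mterm -> mterm.

Fixpoint meval (M : mv) (v : nat -> M) (t : mterm) : M :=
  match t with
  | mvar i => v i
  | mO => mzero
  | mN t1 => mneg (meval M v t1)
  | mA t1 t2 => madd (meval M v t1) (meval M v t2)
  end.

Fixpoint reval (y : nat -> R) (t : mterm) : R :=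
  match t with
  | mvar i => y i
  | mO => 0
  | mN t1 => 1 - reval y t1
  | mA t1 t2 => Rmin 1 (reval y t1 + reval y t2)
  end.

Fixpoint vars_below (n : nat) (t : mterm) : Prop :=
  match t with
  | mvar i => (i < n)%nat
  | mO => True
  | mN t1 => vars_below n t1
  | mA t1 t2 => vars_below n t1 /\ vars_below n t2
  end.

Lemma vars_below_le m n t : (m <= n)%nat -> vars_below m t -> vars_below n t.
Proof.
  intros L. induction t as [i| |t1 IH|t1 IH1 t2 IH2]; simpl; try easy; [lia|tauto].
Qed.

Lemma vars_below_ex t : exists n, vars_below n t.
Proof.
  induction t as [i| |t1 [n1 IH1]|t1 [n1 IH1] t2 [n2 IH2]]; simpl.
  - exists (S i). lia.
  - now exists O.
  - now exists n1.
  - exists (Nat.max n1 n2). split; eapply vars_below_le; try eassumption; lia.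
Qed.

Definition r_valid (t s : mterm) : Prop :=
  forall y : nat -> R, (forall i, 0 <= y i <= 1) -> reval y t = reval y s.

(** * Completeness for totally ordered MV-algebras *)

Section ChainCompleteness.

Variable M : mv.
Hypothesis mtotal : forall x y : M, (x ≼ y)%MV \/ (y ≼ x)%MV.
Hypothesis mnontriv : (mzero : M) <> mneg mzero.
Variable c : nat -> M.
Variable n : nat.

Let G : oag := chain_group M mtotal mnontriv.
Let u : G := chain_unit M mtotal mnontriv.
Let emb : M -> G := chain_emb M mtotal mnontriv.
(** Coordinate [0] holds the unit, so the constant [1] becomes a homogeneous linear form;
    MV-variable [j] is shifted to coordinate [S j]. *)
Let g (i : nat) : G := match i with O => u | S j => emb (c j) end.

(** The list [l] records, for each sum in [t], on which side of the truncation the valuation [c]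
    falls. Real points satisfying the same constraints truncate in the same way, so [F] computes the
    term there too. *)
Lemma term_linear_on_region t : vars_below n t ->
  exists F l, rep G g (S n) F (emb (meval M c t)) /\
    (forall b f, In (b, f) l -> gcone G g (S n) b f) /\
    forall x, x O = 1 -> (forall b f, In (b, f) l -> sat b (lin (S n) f x)) ->
      reval (fun i => x (S i)) t = lin (S n) F x.
Proof.
  assert (Hu : rep G g (S n) (basis 0) u) by (apply (rep_basis G g (S n) 0); lia).
  induction t as [i| |t1 IH1|t1 IH1 t2 IH2]; cbn [vars_below meval reval]; intros Hb.
  - exists (basis (S i)), nil. split; [|split].
    + apply (rep_basis G g (S n) (S i)). lia.
    + intros b f [].
    + intros x _ _. rewrite lin_basis by lia. easy.
  - exists (fun _ => 0%Z), nil. split; [|split].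
    + unfold emb. rewrite chain_emb0. apply rep_zero.
    + intros b f [].
    + intros x _ _. generalize (S n) as m. induction m as [|m IH]; simpl; lra.
  - destruct IH1 as [F [l [HF [Hl H]]]]; [easy|].
    exists (fun i => basis 0 i + - F i)%Z, l. split; [|split; [easy|]].
    + replace (emb (mneg (meval M c t1))) with (gadd u (gopp (emb (meval M c t1)))).
      * now apply rep_sub.
      * apply (gadd_cancel _ (emb (meval M c t1))).
        rewrite (gaddC _ u), gaddA, gaddN, gadd0l.
        symmetry. apply chain_emb_neg.
    + intros x Hx Hs. rewrite lin_add, lin_opp, lin_basis, Hx, (H x Hx Hs) by lia. ring.
  - destruct Hb as [Hb1 Hb2].
    destruct (IH1 Hb1) as [F1 [l1 [HF1 [Hl1 H1]]]].
    destruct (IH2 Hb2) as [F2 [l2 [HF2 [Hl2 H2]]]].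
    destruct (chain_emb_add M mtotal mnontriv (meval M c t1) (meval M c t2))
      as [[E L]|[E L]]; fold emb in E, L; apply gle_sub in L.
    + exists (basis 0), ((false, fun i => (F1 i + F2 i) + - basis 0 i)%Z :: l1 ++ l2).
      split; [|split].
      * rewrite E. unfold emb. rewrite chain_emb1. exact Hu.
      * intros b f [Hf|Hf].
        -- injection Hf as <- <-. eexists. split; [|exact L].
           apply rep_sub; [|exact Hu]. now apply rep_add.
        -- apply in_app_or in Hf. destruct Hf; auto.
      * intros x Hx Hs.
        rewrite (H1 x Hx), (H2 x Hx)
          by (intros; apply Hs; right; apply in_or_app; auto).
        assert (S := Hs _ _ (or_introl eq_refl)).
        cbn [sat] in S. rewrite !lin_add, lin_opp in S.
        rewrite lin_basis, Hx in * by lia. rewrite Rmin_left; lra.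
    + exists (fun i => F1 i + F2 i)%Z,
        ((false, fun i => basis 0 i + - (F1 i + F2 i))%Z :: l1 ++ l2).
      split; [|split].
      * rewrite E. now apply rep_add.
      * intros b f [Hf|Hf].
        -- injection Hf as <- <-. eexists. split; [|exact L].
           apply rep_sub; [exact Hu|]. now apply rep_add.
        -- apply in_app_or in Hf. destruct Hf; auto.
      * intros x Hx Hs.
        rewrite (H1 x Hx), (H2 x Hx)
          by (intros; apply Hs; right; apply in_or_app; auto).
        assert (S := Hs _ _ (or_introl eq_refl)).
        cbn [sat] in S. rewrite !lin_add, lin_opp, lin_add in S.
        rewrite lin_basis, Hx in S by lia. rewrite lin_add, Rmin_right; lra.
Qed.

(** The strict inequality between the two forms, positivity of the unit, the bounds on the variables
    and both regions all hold at [g]. A common real solution, rescaled to have unit [1], separates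
    [t] from [s]. *)
Lemma chain_separation t s : vars_below n t -> vars_below n s ->
  ~ gle (emb (meval M c s)) (emb (meval M c t)) -> ~ r_valid t s.
Proof.
  intros Ht Hs Hlt V.
  destruct (term_linear_on_region t Ht) as [F1 [l1 [HF1 [Hl1 H1]]]].
  destruct (term_linear_on_region s Hs) as [F2 [l2 [HF2 [Hl2 H2]]]].
  assert (Hu : rep G g (S n) (basis 0) u) by (apply (rep_basis G g (S n) 0); lia).
  (* The constraints [0 <= x (S i) <= x 0], which put the rescaled point into the unit interval. *)
  set (box := flat_map (fun i => [(false, basis (S i));
                (false, fun j => basis 0 j + - basis (S i) j)%Z]) (seq 0 n)).
  destruct (gcone_solvable G g (S n)
    ((true, basis 0) :: (true, fun i => F2 i + - F1 i)%Z :: box ++ l1 ++ l2)) as [x Hx].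
  { intros b f [Hf|[Hf|Hf]].
    - injection Hf as <- <-. exists u. split; [exact Hu|]. apply chain_unit_nle0.
    - injection Hf as <- <-. eexists. split; [apply rep_sub; [exact HF2|exact HF1]|].
      intros L. now apply Hlt, gsub_le0.
    - apply in_app_or in Hf. destruct Hf as [Hf|Hf].
      + apply in_flat_map in Hf. destruct Hf as [i [Hi Hf]]. apply in_seq in Hi.
        assert (Hr : rep G g (S n) (basis (S i)) (emb (c i)))
          by (apply (rep_basis G g (S n) (S i)); lia).
        destruct Hf as [Hf|[Hf|[]]]; injection Hf as <- <-; eexists.
        * split; [exact Hr|]. apply chain_emb_ge0.
        * split; [apply rep_sub; [exact Hu|exact Hr]|].
          apply (proj1 (gle_sub _ _ _)), chain_emb_le1.
      + apply in_app_or in Hf. destruct Hf; auto. }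
  assert (X0 : 0 < x O).
  { assert (S0 := Hx _ _ (or_introl eq_refl)). cbn [sat] in S0.
    now rewrite lin_basis in S0 by lia. }
  (* All constraints are homogeneous, so they survive division by [x 0]. Coordinates beyond [n] are
     set to [0] because [r_valid] demands values in the unit interval for every variable. *)
  set (x' := fun i => if Nat.ltb i (S n) then / x O * x i else 0).
  assert (Hlin : forall f, lin (S n) f x' = / x O * lin (S n) f x).
  { intros f. rewrite <- lin_scale. apply lin_ext. intros i Hi. unfold x'.
    destruct (Nat.ltb_spec i (S n)); [easy|lia]. }
  assert (I0 : 0 < / x O) by now apply Rinv_0_lt_compat.
  assert (Hx' : forall b f,
    In (b, f) ((true, basis 0) :: (true, fun i => F2 i + - F1 i)%Z :: box ++ l1 ++ l2) ->
    sat b (lin (S n) f x')).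
  { intros b f Hf. rewrite Hlin. specialize (Hx b f Hf). destruct b; unfold sat in *; nra. }
  assert (X1 : x' O = 1).
  { unfold x'. destruct (Nat.ltb_spec 0 (S n)); [|lia]. field. lra. }
  specialize (V (fun i => x' (S i))). cbv beta in V.
  rewrite (H1 x' X1), (H2 x' X1) in V.
  - assert (S1 := Hx' _ _ (or_intror (or_introl eq_refl))). cbn [sat] in S1.
    rewrite lin_add, lin_opp in S1.
    apply Rlt_not_eq with (lin (S n) F1 x') (lin (S n) F2 x'); [lra|]. apply V.
    intros i. destruct (Nat.ltb_spec i n) as [L|L].
    + assert (B : forall f, In (false, f) [(false, basis (S i));
                (false, fun j => basis 0 j + - basis (S i) j)%Z] ->
                0 <= lin (S n) f x').
      { intros f Hf. apply (Hx' false). right. right. apply in_or_app. left.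
        apply in_flat_map. exists i. split; [apply in_seq; lia|exact Hf]. }
      assert (B1 := B _ (or_introl eq_refl)).
      assert (B2 := B _ (or_intror (or_introl eq_refl))).
      rewrite lin_add, lin_opp, !lin_basis in B2 by lia.
      rewrite lin_basis in B1 by lia. lra.
    + unfold x'. destruct (Nat.ltb_spec (S i) (S n)); [lia|lra].
  - intros b f Hf. apply Hx'. right. right. apply in_or_app. right.
    apply in_or_app. now right.
  - intros b f Hf. apply Hx'. right. right. apply in_or_app. right.
    apply in_or_app. now left.
Qed.

End ChainCompleteness.

Lemma chain_completeness (M : mv) (t s : mterm) :
  (forall x y : M, (x ≼ y)%MV \/ (y ≼ x)%MV) -> (mzero : M) <> mneg mzero ->
  r_valid t s -> forall c, meval M c t = meval M c s.
Proof.
  intros Htot Hnt V c.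
  destruct (vars_below_ex t) as [n1 B1], (vars_below_ex s) as [n2 B2].
  apply (vars_below_le _ (Nat.max n1 n2)) in B1, B2; [|lia|lia].
  apply (chain_emb_inj M Htot Hnt). apply gle_antisym; apply NNPP; intros N.
  - apply (chain_separation M Htot Hnt c _ s t B2 B1 N).
    intros y Hy. symmetry. now apply V.
  - now apply (chain_separation M Htot Hnt c _ t s B1 B2 N).
Qed.

(** * Quotients by congruences *)

Section Quotient.

Variable T : Type.
Variable E : T -> T -> Prop.
Variable o : T -> T -> T.
Variable n : T -> T.
Variable z : T.
Hypothesis E_refl : forall x, E x x.
Hypothesis E_sym : forall x y, E x y -> E y x.
Hypothesis E_trans : forall x y w, E x y -> E y w -> E x w.
Hypothesis E_o : forall x x' y y', E x x' -> E y y' -> E (o x y) (o x' y').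
Hypothesis E_n : forall x x', E x x' -> E (n x) (n x').
Hypothesis oA : forall x y w, E (o x (o y w)) (o (o x y) w).
Hypothesis oC : forall x y, E (o x y) (o y x).
Hypothesis o0 : forall x, E (o x z) x.
Hypothesis nK : forall x, E (n (n x)) x.
Hypothesis o1 : forall x, E (o x (n z)) (n z).
Hypothesis luk : forall x y, E (o (n (o (n x) y)) y) (o (n (o (n y) x)) x).

Definition qcar : Type := {P : T -> Prop | exists x, P = E x}.

Definition qcls (x : T) : qcar := exist _ (E x) (ex_intro _ x eq_refl).

Definition qrepr (a : qcar) : T :=
  proj1_sig (constructive_indefinite_description _ (proj2_sig a)).

Lemma qcls_eq x y : qcls x = qcls y <-> E x y.
Proof.
  split; intros H.
  - apply (f_equal (@proj1_sig _ _)) in H. simpl in H. rewrite H. apply E_refl.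
  - apply eq_sig_hprop; [intros; apply proof_irrelevance|]. simpl.
    apply functional_extensionality; intros w. apply propositional_extensionality.
    split; intros Hw; eauto.
Qed.

Lemma qreprK a : qcls (qrepr a) = a.
Proof.
  apply eq_sig_hprop; [intros; apply proof_irrelevance|]. simpl. unfold qrepr.
  now destruct (constructive_indefinite_description _ (proj2_sig a)).
Qed.

Lemma qrepr_cls x : E (qrepr (qcls x)) x.
Proof. apply qcls_eq, qreprK. Qed.

Definition qadd (a b : qcar) : qcar := qcls (o (qrepr a) (qrepr b)).
Definition qneg (a : qcar) : qcar := qcls (n (qrepr a)).

Lemma qadd_cls x y : qadd (qcls x) (qcls y) = qcls (o x y).
Proof. apply qcls_eq, E_o; apply qrepr_cls. Qed.

Lemma qneg_cls x : qneg (qcls x) = qcls (n x).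
Proof. apply qcls_eq, E_n, qrepr_cls. Qed.

(** The MV-laws are required only up to [E]. This serves both for the congruence of an ideal and for
    equality of positive parts in a strong quasi-MV* algebra. *)
Lemma mv_quotient : exists (Q : mv) (h : T -> Q),
  (forall x y, h (o x y) = madd (h x) (h y)) /\ (forall x, h (n x) = mneg (h x)) /\
  h z = mzero /\ (forall x y, h x = h y <-> E x y) /\ (forall a, exists x, h x = a).
Proof.
  unshelve eexists (MV qcar qadd qneg (qcls z) _ _ _ _ _ _).
  - intros a b c. rewrite <- (qreprK a), <- (qreprK b), <- (qreprK c).
    rewrite !qadd_cls. apply qcls_eq, oA.
  - intros a b. rewrite <- (qreprK a), <- (qreprK b).
    rewrite !qadd_cls. apply qcls_eq, oC.
  - intros a. rewrite <- (qreprK a). rewrite !qadd_cls. apply qcls_eq, o0.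
  - intros a. rewrite <- (qreprK a). rewrite !qneg_cls. apply qcls_eq, nK.
  - intros a. rewrite <- (qreprK a).
    rewrite !qneg_cls, !qadd_cls. apply qcls_eq, o1.
  - intros a b. rewrite <- (qreprK a), <- (qreprK b).
    repeat rewrite ?qneg_cls, ?qadd_cls. apply qcls_eq, luk.
  - exists qcls. split; [|split; [|split; [|split]]].
    + intros x y. symmetry. apply qadd_cls.
    + intros x. symmetry. apply qneg_cls.
    + reflexivity.
    + exact qcls_eq.
    + intros a. exists (qrepr a). apply qreprK.
Qed.

End Quotient.

(** * Prime ideals of MV-algebras *)

Section PrimeIdeals.

Variable M : mv.
Local Open Scope mv_scope.
Implicit Types a b c x y : M.

(** The empty set counts as an ideal, so that the union of the empty chain is covered in Zorn's
    lemma; membership of [0] is stated separately. *)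
Definition ideal (I : M -> Prop) : Prop :=
  (forall x y, y ≼ x -> I x -> I y) /\ (forall x y, I x -> I y -> I (x ⊕ y)).

Fixpoint mmuln (k : nat) (x : M) : M :=
  match k with
  | O => 0
  | S j => x ⊕ mmuln j x
  end.

Lemma mmuln_add j k x : mmuln (j + k) x = mmuln j x ⊕ mmuln k x.
Proof. induction j as [|j IH]; simpl; [now rewrite madd0l|]. now rewrite IH, maddA. Qed.

Lemma mdisj_muln a b j k : mdisj M a b -> mdisj M (mmuln j a) (mmuln k b).
Proof.
  assert (D : forall a b k, mdisj M a b -> mdisj M a (mmuln k b)).
  { clear. intros a b k H. induction k as [|k IH]; simpl.
    - intros d _ Hd. now apply mle0_eq.
    - now apply mdisj_add. }
  intros H. now apply D, mdisj_sym, D, mdisj_sym.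
Qed.

Lemma mle_add2 a b x y : a ≼ x -> b ≼ y -> a ⊕ b ≼ x ⊕ y.
Proof. intros H1 H2. apply mle_trans with (x ⊕ b); [now apply mle_add | now apply mle_addl]. Qed.

(** The set is the ideal generated by [I] and [a]. *)
Lemma ideal_extend I a : ideal I -> I 0 ->
  ideal (fun x => exists i k, I i /\ x ≼ i ⊕ mmuln k a).
Proof.
  intros [Hd Ha] H0. split.
  - intros x y L (i & k & Hi & H). exists i, k. split; [easy|]. now apply mle_trans with x.
  - intros x y (i & k & Hi & H) (j & l & Hj & H'). exists (i ⊕ j), (k + l)%nat.
    split; [auto|]. rewrite mmuln_add.
    replace (i ⊕ j ⊕ (mmuln k a ⊕ mmuln l a)) with ((i ⊕ mmuln k a) ⊕ (j ⊕ mmuln l a)).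
    + now apply mle_add2.
    + rewrite <- !maddA. f_equal. apply maddCA.
Qed.

Lemma ideal_avoiding_maximal c : c <> 0 ->
  exists I, (ideal I /\ I 0 /\ ~ I c) /\
    forall J, ideal J -> (forall x, I x -> J x) -> ~ J c -> forall x, J x -> I x.
Proof.
  intros Hc.
  destruct (@classical_sets.Zorn_bigcup M (fun I => ideal I /\ ~ I c)) as [I [[HI Ic] Hmax]].
  - intros F HF Htot. split; [split|].
    + intros x y L [X FX Xx]. exists X; [exact FX|]. destruct (HF X FX) as [[Hd _] _].
      now apply Hd with x.
    + intros x y [X FX Xx] [Y FY Yy].
      destruct (Htot X Y FX FY) as [L|L].
      * exists Y; [exact FY|]. destruct (HF Y FY) as [[_ Ha] _]. apply Ha; [now apply L|easy].
      * exists X; [exact FX|]. destruct (HF X FX) as [[_ Ha] _]. apply Ha; [easy|now apply L].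
    + intros [X FX Xc]. now destruct (HF X FX).
  - assert (Max : forall J, ideal J -> (forall x, I x -> J x) -> ~ J c ->
              forall x, J x -> I x).
    { intros J HJ L Jc x Jx. apply NNPP. intros N. apply (Hmax J); [|easy].
      split; [exact L|]. intros L'. now apply N, L'. }
    exists I. split; [|exact Max]. split; [exact HI|split; [|exact Ic]].
    destruct HI as [Hd Ha].
    (* Adjoining [0] to [I] keeps it an ideal avoiding [c], so maximality puts [0] into [I]. *)
    apply (Max (fun x => x = 0 \/ I x)); [|now right| |now left].
    + split.
      * intros x y L [->|Hx]; [left; now apply mle0_eq|right; now apply Hd with x].
      * intros x y [->|Hx] [->|Hy]; rewrite ?madd0, ?madd0l; auto.
    + now intros [E|E].
Qed.

(** If neither difference is in [I], maximality puts [c] below [i ⊕ k (x ⊖ y)] and below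
    [j ⊕ l (y ⊖ x)] with [i], [j] in [I]. Then [c ⊖ (i ⊕ j)] is below multiples of two disjoint
    elements, hence is [0], and [c] would be in [I]. *)
Lemma prime_ideal_avoiding c : c <> 0 ->
  exists I, ideal I /\ I 0 /\ ~ I c /\ forall x y, I (x ⊖ y) \/ I (y ⊖ x).
Proof.
  intros Hc. destruct (ideal_avoiding_maximal c Hc) as [I [(HI & I0 & Ic) Max]].
  exists I. split; [easy|]. split; [easy|]. split; [easy|]. intros x y.
  assert (Ext : forall a, ~ I a -> exists i k, I i /\ c ≼ i ⊕ mmuln k a).
  { intros a Na. apply NNPP. intros N. apply Na.
    apply (Max _ (ideal_extend I a HI I0)).
    - intros w Hw. exists w, O. split; [easy|]. simpl. rewrite madd0. apply mle_refl.
    - exact N.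
    - exists 0, 1%nat. split; [easy|]. simpl. rewrite madd0, madd0l. apply mle_refl. }
  destruct (classic (I (x ⊖ y))) as [H|H1]; [now left|].
  destruct (classic (I (y ⊖ x))) as [H|H2]; [now right|].
  destruct (Ext _ H1) as (i & k & Hi & Li), (Ext _ H2) as (j & l & Hj & Lj).
  exfalso. apply Ic. destruct HI as [Hd Ha].
  apply Hd with (i ⊕ j); [|now apply Ha].
  apply msub_eq0. apply (mdisj_muln _ _ k l (mdisj_sub M x y)); apply mle_sub.
  - apply mle_trans with (1 := Li). apply mle_add, mle_addr.
  - apply mle_trans with (1 := Lj). apply mle_add. rewrite (maddC _ i). apply mle_addr.
Qed.

End PrimeIdeals.

Lemma meval_morph (M N : mv) (h : M -> N) :
  (forall x y, h (madd x y) = madd (h x) (h y)) ->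
  (forall x, h (mneg x) = mneg (h x)) -> h mzero = mzero ->
  forall v t, h (meval M v t) = meval N (fun i => h (v i)) t.
Proof.
  intros HA HN H0 v t. induction t as [i| |t1 IH1|t1 IH1 t2 IH2]; simpl; congruence.
Qed.

(** * The quotient of an MV-algebra by an ideal *)

Section IdealQuotient.

Variable M : mv.
Variable I : M -> Prop.
Local Open Scope mv_scope.
Hypothesis HI : ideal M I.
Hypothesis I0 : I 0.

Definition ideal_eq (x y : M) : Prop := I (x ⊖ y) /\ I (y ⊖ x).

Lemma ideal_eq_refl x : ideal_eq x x.
Proof. unfold ideal_eq. now rewrite (proj2 (msub_eq0 M x x) (mle_refl M x)). Qed.

Lemma ideal_sub_trans x y z : I (x ⊖ y) -> I (y ⊖ z) -> I (x ⊖ z).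
Proof.
  intros H1 H2. destruct HI as [Hd Ha].
  apply Hd with ((y ⊖ z) ⊕ (x ⊖ y)); [|now apply Ha].
  apply mle_sub. rewrite (maddA _ z).
  apply mle_trans with (y ⊕ (x ⊖ y)); [apply mle_add_sub|apply mle_add, mle_add_sub].
Qed.

Lemma ideal_sub_add x x' y y' : I (x ⊖ x') -> I (y ⊖ y') -> I ((x ⊕ y) ⊖ (x' ⊕ y')).
Proof.
  intros H1 H2. destruct HI as [Hd Ha].
  apply Hd with ((x ⊖ x') ⊕ (y ⊖ y')); [|now apply Ha].
  apply mle_sub.
  replace (x' ⊕ y' ⊕ ((x ⊖ x') ⊕ (y ⊖ y'))) with ((x' ⊕ (x ⊖ x')) ⊕ (y' ⊕ (y ⊖ y'))).
  - apply mle_add2; apply mle_add_sub.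
  - rewrite <- !maddA. f_equal. apply maddCA.
Qed.

Lemma mv_ideal_quotient : exists (Q : mv) (h : M -> Q),
  (forall x y, h (x ⊕ y) = h x ⊕ h y) /\ (forall x, h (¬x) = ¬ h x) /\
  h 0 = 0 /\ (forall x y, h x = h y <-> ideal_eq x y) /\ (forall a, exists x, h x = a).
Proof.
  apply (mv_quotient M ideal_eq madd mneg mzero).
  - exact ideal_eq_refl.
  - now intros x y [H1 H2].
  - intros x y w [H1 H2] [H3 H4]. split; eapply ideal_sub_trans; eassumption.
  - intros x x' y y' [H1 H2] [H3 H4]. split; now apply ideal_sub_add.
  - intros x x' [H1 H2]. split; rewrite mnegK, maddC; assumption.
  - intros x y w. rewrite maddA. apply ideal_eq_refl.
  - intros x y. rewrite maddC. apply ideal_eq_refl.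
  - intros x. rewrite madd0. apply ideal_eq_refl.
  - intros x. rewrite mnegK. apply ideal_eq_refl.
  - intros x. rewrite madd1. apply ideal_eq_refl.
  - intros x y. rewrite mluk. apply ideal_eq_refl.
Qed.

End IdealQuotient.

Theorem mv_completeness (M : mv) (t s : mterm) : r_valid t s ->
  forall v, meval M v t = meval M v s.
Proof.
  (* By antisymmetry one inequality suffices. A nonzero difference [c] of the values stays nonzero
     modulo a prime ideal avoiding it, and that quotient is totally ordered. *)
  assert (Half : forall t s, r_valid t s -> forall v,
    madd (mneg (meval M v t)) (meval M v s) = mneg mzero).
  { clear t s. intros t s V v. apply msub_eq0. apply NNPP. intros Hc.
    set (c := mneg (madd (mneg (meval M v t)) (meval M v s))) in *.
    destruct (prime_ideal_avoiding M c Hc) as (I & HI & I0 & Ic & Ip).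
    destruct (mv_ideal_quotient M I HI I0) as (Q & h & hA & hN & h0 & hE & hS).
    assert (hle : forall x y, I (mneg (madd (mneg x) y)) ->
              madd (mneg (h x)) (h y) = mneg mzero).
    { intros x y H. apply msub_eq0. rewrite <- hN, <- hA, <- hN, <- h0. apply hE. split.
      - now rewrite madd0, mnegK.
      - now rewrite madd1l, mnegK. }
    assert (hc : h c <> mzero).
    { rewrite <- h0. intros [H _]%hE. apply Ic.
      now rewrite madd0, mnegK in H. }
    apply hc. unfold c. rewrite hN, hA, hN, !(meval_morph M Q h) by assumption.
    apply msub_eq0. rewrite (chain_completeness Q t s).
    - apply mle_refl.
    - intros a b. destruct (hS a) as [x <-], (hS b) as [y <-].
      destruct (Ip x y); [left|right]; now apply hle.
    - intros E. apply hc. now rewrite (mle_eq1 Q _ (h c) E (mle0 _ _)).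
    - exact V. }
  intros V v. apply mle_antisym; apply Half; [exact V|].
  intros y Hy. symmetry. now apply V.
Qed.

(** * Positive elements of a strong quasi-MV* algebra *)

Section Positive.

Variable A : alg.
Hypothesis HA : is_sqmvstar A.

Notation o := (aoplus A).
Notation n := (aneg A).
Notation p := (aplus A).
Notation m := (aminus A).
Notation z := (azero A).
Notation u := (aone A).

Lemma sq_comm x y : o x y = o y x.
Proof. destruct HA as [Q _]. apply Q. Qed.

Lemma sq_assoc_unit x y w : o (o u x) (o y (o u w)) = o (o (o u x) y) (o u w).
Proof. destruct HA as [Q _]. apply Q. Qed.

Lemma sq_absorb x : o (o x u) u = u.
Proof. destruct HA as [Q _]. apply Q. Qed.

Lemma sq_add0 x y : o (o x y) z = o x y.
Proof. destruct HA as [Q _]. apply Q. Qed.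

Lemma sq_plusE x : p x = o u (o (n u) x).
Proof.
  destruct HA as [(_ & _ & _ & _ & P & _) [S _]]. destruct (P x) as [P1 P2].
  rewrite S. cbv zeta in *. congruence.
Qed.

Lemma sq_minusE x : m x = o (n u) (o u x).
Proof.
  destruct HA as [(_ & _ & _ & _ & _ & P & _) [_ S]]. destruct (P x) as [P1 P2].
  rewrite S. cbv zeta in *. congruence.
Qed.

Lemma sq_split x y : o x y = o (o (p x) (p y)) (o (m x) (m y)).
Proof. destruct HA as [(_ & _ & _ & _ & _ & _ & Q & _) _]. apply Q. Qed.

Lemma sq_neg0 : n z = z.
Proof. destruct HA as [(_ & _ & _ & _ & _ & _ & _ & Q & _) _]. now symmetry. Qed.

Lemma sq_addN x : o x (n x) = z.
Proof. destruct HA as [(_ & _ & _ & _ & _ & _ & _ & _ & Q & _) _]. apply Q. Qed.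

Lemma sq_negD x y : n (o x y) = o (n x) (n y).
Proof. destruct HA as [(_ & _ & _ & _ & _ & _ & _ & _ & _ & Q & _) _]. apply Q. Qed.

Lemma sq_negK x : n (n x) = x.
Proof. destruct HA as [(_ & _ & _ & _ & _ & _ & _ & _ & _ & _ & Q & _) _]. apply Q. Qed.

Lemma sq_joinC x y : ajoin A x y = ajoin A y x.
Proof.
  destruct HA as [(_ & _ & _ & _ & _ & _ & _ & _ & _ & _ & _ & _ & Q & _) _]. apply Q.
Qed.

Lemma sq_unit0 : o u z = u.
Proof. rewrite <- (sq_absorb z). apply sq_add0. Qed.

Lemma sq_zero0 : o z z = z.
Proof. rewrite <- (sq_addN z) at 1 3. apply sq_add0. Qed.

Lemma sq_absorb_l x : o u (o u x) = u.
Proof. rewrite (sq_comm u x), sq_comm. apply sq_absorb. Qed.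

Lemma sq_unit_unit : o u u = u.
Proof. rewrite <- sq_unit0 at 2. apply sq_absorb_l. Qed.

Lemma sq_negu0 : o (n u) z = n u.
Proof. rewrite <- sq_neg0 at 1. now rewrite <- sq_negD, sq_unit0. Qed.

Lemma sq_plus0 : p z = z.
Proof. rewrite sq_plusE, sq_negu0. apply sq_addN. Qed.

(** Splitting [u ⊕ x] into positive and negative parts, [u] absorbs the positive part of [x] and has
    negative part [z]. It follows that [u ⊕ x] is its own positive part. *)
Lemma sq_add_minus x : o u (m x) = o u x.
Proof.
  assert (pu : p u = u).
  { rewrite sq_plusE, (sq_comm (n u)), sq_addN. apply sq_unit0. }
  assert (mu : m u = z).
  { rewrite sq_minusE, sq_unit_unit, sq_comm. apply sq_addN. }
  rewrite (sq_split u x), pu, mu, (sq_plusE x), sq_absorb_l, (sq_comm z).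
  now rewrite (sq_minusE x), sq_add0.
Qed.

Lemma sq_plus_unit x : p (o u x) = o u x.
Proof. rewrite sq_plusE, <- sq_minusE. apply sq_add_minus. Qed.

Lemma sq_plusK x : p (p x) = p x.
Proof. rewrite (sq_plusE x). apply sq_plus_unit. Qed.

(** The axioms give associativity when the outer summands have the form [u ⊕ _]; positive parts have
    it by [sq_plusE]. *)
Lemma sq_plusA x y w : o (p x) (o y (p w)) = o (o (p x) y) (p w).
Proof. rewrite (sq_plusE x), (sq_plusE w). apply sq_assoc_unit. Qed.

Lemma sq_unitA y w : o u (o y (p w)) = o (o u y) (p w).
Proof.
  pose proof (sq_assoc_unit z y (o (n u) w)) as H.
  now rewrite sq_unit0, <- sq_plusE in H.
Qed.

Lemma sq_plusD x y : p (o (p x) (p y)) = o (p x) (p y).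
Proof. rewrite (sq_plusE x), <- sq_unitA. apply sq_plus_unit. Qed.

Lemma sq_plus_add0 x : p (o x z) = p x.
Proof.
  destruct HA as [(_ & _ & _ & _ & P & _) [S _]]. destruct (P x) as [P1 _].
  rewrite S. cbv zeta in *. congruence.
Qed.

Lemma sq_minus_plus x : m (p x) = z.
Proof. rewrite sq_minusE, sq_plusE, sq_absorb_l, sq_comm. apply sq_addN. Qed.

Lemma sq_minus_neg x : m x = n (p (n x)).
Proof. now rewrite sq_plusE, !sq_negD, !sq_negK, sq_minusE. Qed.

(** The right side has the form of the MV-difference [¬(¬x ⊕ p y)] for the negation [u ⊕ - x]. *)
Lemma sq_plus_diff x y : p (o x (n (p y))) = o u (n (o (o u (n x)) (p y))).
Proof.
  rewrite sq_plusE. f_equal. rewrite <- sq_unitA, !sq_negD, sq_negK. reflexivity.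
Qed.

Lemma sq_plus_neg_plus x : p (n (p x)) = z.
Proof.
  rewrite sq_plusE, <- sq_negD, sq_plusE, sq_absorb_l. apply sq_addN.
Qed.

(** On positive parts the negative half of [ajoin] vanishes, so commutativity of the join becomes
    the Łukasiewicz law. *)
Lemma sq_plus_add_diffC x y :
  o (p x) (p (o (p y) (n (p x)))) = o (p y) (p (o (p x) (n (p y)))).
Proof.
  assert (J : forall x y, ajoin A (p x) (p y) = o (p x) (p (o (p y) (n (p x))))).
  { clear x y. intros x y. unfold ajoin.
    rewrite !sq_plusK, !sq_minus_plus, sq_neg0, sq_zero0, sq_plus0, sq_zero0, sq_add0.
    now rewrite (sq_comm (n (p x))). }
  rewrite <- !J. apply sq_joinC.
Qed.

(** Taking positive parts of the arguments makes the operations total on [A] and compatible with the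
    relation [p x = p y]. *)
Definition pos_add (x y : A) : A := o (p x) (p y).
Definition pos_neg (x : A) : A := o u (n (p x)).

Lemma pos_mv : exists (Q : mv) (h : A -> Q),
  (forall x y, h (pos_add x y) = madd (h x) (h y)) /\
  (forall x, h (pos_neg x) = mneg (h x)) /\
  h z = mzero /\ (forall x y, h x = h y <-> p x = p y).
Proof.
  assert (pD : forall x y, p (pos_add x y) = o (p x) (p y)) by (intros; apply sq_plusD).
  assert (pN : forall x, p (pos_neg x) = o u (n (p x))) by (intros; apply sq_plus_unit).
  destruct (mv_quotient A (fun x y => p x = p y) pos_add pos_neg z)
    as (Q & h & hA & hN & h0 & hE & _).
  - reflexivity.
  - now symmetry.
  - intros; etransitivity; eassumption.
  - intros x x' y y' H1 H2. unfold pos_add. now rewrite H1, H2.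
  - intros x x' H. unfold pos_neg. now rewrite H.
  - intros x y w. rewrite !pD. apply sq_plusA.
  - intros x y. now rewrite !pD, sq_comm.
  - intros x. rewrite pD, sq_plus0, (sq_plusE x). apply sq_add0.
  - intros x. rewrite !pN, sq_negD, sq_negK, <- sq_plusE. apply sq_plusK.
  - intros x. rewrite pD, pN, sq_plus0, sq_neg0, sq_unit0, sq_comm, (sq_plusE x).
    apply sq_absorb_l.
  - assert (D : forall x y, p (pos_add (pos_neg (pos_add (pos_neg x) y)) y) =
              o (p y) (p (o (p x) (n (p y))))).
    { intros x y. rewrite !pD, !pN, !pD, pN, <- sq_plus_diff. apply sq_comm. }
    intros x y. rewrite !D. apply sq_plus_add_diffC.
  - now exists Q, h.
Qed.

Lemma sq_split_diff x y :
  o x y = o (p (pos_add x y)) (n (p (pos_add (n x) (n y)))).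
Proof.
  unfold pos_add. now rewrite !sq_plusD, sq_negD, <- !sq_minus_neg, <- sq_split.
Qed.

(** Splitting [x ⊕ 0] expresses [x] through [p x] and [m x], and [m x] is [- p (- x)]. *)
Lemma regular_ext x y : o x z = x -> o y z = y -> p x = p y -> p (n x) = p (n y) -> x = y.
Proof.
  intros Hx Hy H1 H2. rewrite <- Hx, <- Hy, (sq_split x), (sq_split y).
  now rewrite (sq_minus_neg x), (sq_minus_neg y), H1, H2.
Qed.

End Positive.

(** * Translation into MV-terms *)

Definition mdiff (a b : mterm) : mterm := mN (mA (mN a) b).

(* MV-terms for the positive parts of [t] and of [- t]. A variable [x] becomes a
   truncated difference of two MV-variables, which makes its two parts disjoint. *)
Fixpoint trans (t : term) : mterm * mterm :=
  match t with
  | tvar i => (mdiff (mvar (2 * i)) (mvar (S (2 * i))),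
               mdiff (mvar (S (2 * i))) (mvar (2 * i)))
  | tzero => (mO, mO)
  | tone => (mN mO, mO)
  | toplus t1 t2 =>
      let P := mA (fst (trans t1)) (fst (trans t2)) in
      let N := mA (snd (trans t1)) (snd (trans t2)) in
      (mdiff P N, mdiff N P)
  | tneg t1 => (snd (trans t1), fst (trans t1))
  | tplus t1 => (fst (trans t1), mO)
  | tminus t1 => (mO, snd (trans t1))
  end.

Lemma trans_eval (A : alg) : is_sqmvstar A ->
  forall (v : nat -> A) t s,
    r_valid (fst (trans t)) (fst (trans s)) -> r_valid (snd (trans t)) (snd (trans s)) ->
    aplus A (eval A v t) = aplus A (eval A v s) /\
    aplus A (aneg A (eval A v t)) = aplus A (aneg A (eval A v s)).
Proof.
  intros HA v t s V1 V2.
  destruct (pos_mv A HA) as (Q & h & hA & hN & h0 & hE).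
  (* Even MV-variables stand for the positive parts of the [v i], odd ones for those of the [- v i],
     as in [trans]. *)
  set (w := fun i => if Nat.even i then h (v (Nat.div2 i)) else h (aneg A (v (Nat.div2 i)))).
  (* The case of sums in [trans]: [sq_split_diff] writes a sum as a difference of two MV-sums, and
     its positive part is the truncated difference. *)
  assert (hD : forall x y, h (aoplus A x y) =
    mneg (madd (mneg (madd (h x) (h y))) (madd (h (aneg A x)) (h (aneg A y))))).
  { intros x y. rewrite <- !hA, <- hN, <- hA, <- hN. apply hE.
    rewrite (sq_split_diff A HA x y), (sq_plus_diff A HA).
    unfold pos_neg at 1. rewrite (sq_plus_unit A HA).
    unfold pos_add at 3. rewrite (sq_plusD A HA).
    unfold pos_neg. now rewrite (sq_plus_unit A HA). }
  (* Subtracting the negative part does not change the positive part: apply the formula for sums to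
     [x ⊕ 0], which has the same positive part as [x]. *)
  assert (hd : forall x, mneg (madd (mneg (h x)) (h (aneg A x))) = h x).
  { intros x. transitivity (h (aoplus A x (azero A))).
    - now rewrite hD, (sq_neg0 A HA), h0, !madd0.
    - apply hE, (sq_plus_add0 A HA). }
  assert (hp : forall x, h (aplus A x) = h x) by (intros; apply hE, (sq_plusK A HA)).
  assert (hnp : forall x, h (aneg A (aplus A x)) = mzero).
  { intros x. rewrite <- h0. apply hE.
    rewrite (sq_plus_neg_plus A HA). symmetry. apply (sq_plus0 A HA). }
  assert (T : forall t, h (eval A v t) = meval Q w (fst (trans t)) /\
                        h (aneg A (eval A v t)) = meval Q w (snd (trans t))).
  { clear t s V1 V2.
    induction t as [i| | |t1 [P1 N1] t2 [P2 N2]|t1 [P1 N1]|t1 [P1 N1]|t1 [P1 N1]];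
      cbn [eval trans fst snd mdiff meval].
    - assert (W0 : w (2 * i)%nat = h (v i)).
      { unfold w. now rewrite Nat.even_even, Nat.div2_double. }
      assert (W1 : w (S (2 * i)) = h (aneg A (v i))).
      { unfold w. rewrite Nat.even_succ, Nat.odd_even, Nat.div2_succ_double. easy. }
      rewrite W0, W1. split; [now rewrite hd|].
      pose proof (hd (aneg A (v i))) as H. rewrite (sq_negK A HA) in H. now symmetry.
    - now rewrite (sq_neg0 A HA), h0.
    - assert (H1 : h (aone A) = mneg mzero).
      { rewrite <- h0, <- hN. apply hE. unfold pos_neg.
        now rewrite (sq_plus0 A HA), (sq_neg0 A HA), (sq_unit0 A HA). }
      split; [exact H1|].
      rewrite <- (sq_unit0 A HA) at 1. rewrite <- (sq_plus_unit A HA). apply hnp.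
    - rewrite <- P1, <- P2, <- N1, <- N2. split; [apply hD|].
      rewrite (sq_negD A HA), hD. now rewrite !(sq_negK A HA).
    - now rewrite (sq_negK A HA).
    - now rewrite hp, hnp.
    - now rewrite (sq_minus_neg A HA), hnp, (sq_negK A HA), hp. }
  destruct (T t) as [Pt Nt], (T s) as [Ps Ns].
  split; apply hE.
  - rewrite Pt, Ps. now apply mv_completeness.
  - rewrite Nt, Ns. now apply mv_completeness.
Qed.

(** * The square standard algebra *)

Ltac case_clamp :=
  unfold clamp, Rmax, Rmin in *; repeat (destruct Rle_dec; try lra); lra.

Lemma Spt_ext (x y : Spt) : sa x = sa y -> sb x = sb y -> x = y.
Proof.
  destruct x as [a b H1 H2 H3 H4], y as [c d K1 K2 K3 K4]; simpl. intros -> ->.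
  f_equal; apply proof_irrelevance.
Qed.

(** The inner sums are differences of two numbers in [[0,1]] or of two in [[-1,0]], so clamping does
    not affect them; the rest is a case split on signs. *)
Lemma sa_join (x y : Spt) : sa (ajoin Sstar x y) = Rmax (sa x) (sa y).
Proof.
  destruct x as [a b H1 H2 H3 H4], y as [c d K1 K2 K3 K4].
  unfold ajoin; cbn [aoplus aneg aplus aminus Sstar S_oplus S_neg S_plus S_minus sa].
  clear H3 H4 K3 K4.
  replace (clamp (- Rmax 0 a + Rmax 0 c)) with (- Rmax 0 a + Rmax 0 c) by case_clamp.
  replace (clamp (- Rmin 0 a + Rmin 0 c)) with (- Rmin 0 a + Rmin 0 c) by case_clamp.
  destruct (Rle_dec 0 a), (Rle_dec 0 c);
    rewrite ?(Rmax_right 0 a), ?(Rmax_left 0 a), ?(Rmax_right 0 c), ?(Rmax_left 0 c),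
      ?(Rmin_right 0 a), ?(Rmin_left 0 a), ?(Rmin_right 0 c), ?(Rmin_left 0 c) by lra;
    case_clamp.
Qed.

Lemma Sstar_sqmvstar : is_sqmvstar Sstar.
Proof.
  assert (J : forall x y : Spt, sb (ajoin Sstar x y) = 0) by reflexivity.
  unfold is_sqmvstar, is_qmvstar. cbv zeta. repeat split; intros;
    apply Spt_ext; try reflexivity; rewrite ?J, ?sa_join; try reflexivity.
  all: repeat match goal with x : car Sstar |- _ =>
    let a := fresh "a" in let b := fresh "b" in destruct x as [a b ? ? ? ?] end.
  all: cbn [aoplus aneg aplus aminus azero aone Sstar S_oplus S_neg S_plus S_minus
            S_zero S_one sa sb].
  all: try case_clamp.
  (* What is left is distributivity over the join, whose inner join is exposed only once the outer
     sum is reduced. *)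
  rewrite sa_join. cbn [sa]. case_clamp.
Qed.

(** The point of the square matching the translation of a variable: its positive part and that of
    its negative are the two truncated differences in [trans]. *)
Definition Sdiff_val (y : nat -> R) (Hy : forall i, 0 <= y i <= 1) (i : nat) : Spt.
Proof.
  refine (MkS (y (2 * i)%nat - y (S (2 * i))) 0 _ _ m1_le0 z_le1).
  - pose proof (Hy (2 * i)%nat); pose proof (Hy (S (2 * i))); lra.
  - pose proof (Hy (2 * i)%nat); pose proof (Hy (S (2 * i))); lra.
Defined.

Lemma reval_mdiff y a b : reval y b <= 1 -> reval y (mdiff a b) = Rmax 0 (reval y a - reval y b).
Proof. intros H. cbn [mdiff reval]. case_clamp. Qed.

(** The real counterpart of the translation of sums: truncating the two partial sums at [1] before
    subtracting does not alter the positive part of the clamped sum. *)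
Lemma clamp_parts a b : -1 <= a <= 1 -> -1 <= b <= 1 ->
  Rmax 0 (Rmin 1 (Rmax 0 a + Rmax 0 b) - Rmin 1 (Rmax 0 (- a) + Rmax 0 (- b))) =
  Rmax 0 (clamp (a + b)).
Proof.
  intros Ha Hb.
  destruct (Rle_dec 0 a), (Rle_dec 0 b);
    rewrite ?(Rmax_right 0 a), ?(Rmax_left 0 a), ?(Rmax_right 0 b), ?(Rmax_left 0 b),
      ?(Rmax_right 0 (- a)), ?(Rmax_left 0 (- a)), ?(Rmax_right 0 (- b)),
      ?(Rmax_left 0 (- b)) by lra;
    case_clamp.
Qed.

Lemma trans_reval y Hy t :
  reval y (fst (trans t)) = Rmax 0 (sa (eval Sstar (Sdiff_val y Hy) t)) /\
  reval y (snd (trans t)) = Rmax 0 (- sa (eval Sstar (Sdiff_val y Hy) t)).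
Proof.
  induction t as [i| | |t1 [P1 N1] t2 [P2 N2]|t1 [P1 N1]|t1 [P1 N1]|t1 [P1 N1]];
    cbn [trans fst snd];
    cbn [eval Sstar aoplus aneg aplus aminus azero aone
         S_oplus S_neg S_plus S_minus S_zero S_one sa].
  - rewrite !reval_mdiff by apply Hy. split; f_equal; simpl; ring.
  - simpl. split; case_clamp.
  - simpl. split; case_clamp.
  - rewrite !reval_mdiff by apply Rmin_l. cbn [reval]. rewrite P1, P2, N1, N2.
    destruct (eval Sstar (Sdiff_val y Hy) t1) as [a ? ? ? ? ?].
    destruct (eval Sstar (Sdiff_val y Hy) t2) as [c ? ? ? ? ?]. cbn [sa].
    split; [now apply clamp_parts|].
    replace (- clamp (a + c)) with (clamp (- a + - c)) by case_clamp.
    rewrite <- clamp_parts by lra. now rewrite !Ropp_involutive.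
  - rewrite P1, N1. now rewrite Ropp_involutive.
  - rewrite P1. cbn [reval]. split; case_clamp.
  - rewrite N1. cbn [reval]. split; case_clamp.
Qed.

Lemma Sstar_models_trans t s : Sstar_models t s ->
  r_valid (fst (trans t)) (fst (trans s)) /\ r_valid (snd (trans t)) (snd (trans s)).
Proof.
  intros H. split; intros y Hy;
    destruct (trans_reval y Hy t) as [Pt Nt], (trans_reval y Hy s) as [Ps Ns].
  - now rewrite Pt, Ps, H.
  - now rewrite Nt, Ns, H.
Qed.

(** * Variables under negations and the second coordinate *)

(* [Some (b, i)] when the term is the variable [i] under negations, [b] recording their
   parity; these are the only terms whose values need not satisfy [x ⊕ 0 = x]. *)
Fixpoint literal (t : term) : option (bool * nat) :=
  match t with
  | tvar i => Some (false, i)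
  | tneg t1 => option_map (fun c => (negb (fst c), snd c)) (literal t1)
  | _ => None
  end.

Lemma literal_eval (A : alg) (v : nat -> A) t b i : is_sqmvstar A ->
  literal t = Some (b, i) -> eval A v t = if b then aneg A (v i) else v i.
Proof.
  intros HA. revert b i. induction t as [j| | | |t1 IH| |]; simpl; intros b i H; try easy.
  - now injection H as <- <-.
  - destruct (literal t1) as [[b1 i1]|]; [|easy]. injection H as <- <-. simpl.
    rewrite (IH b1 i1) by easy. destruct b1; [apply (sq_negK A HA)|easy].
Qed.

Lemma literal_none_regular (A : alg) (v : nat -> A) t : is_sqmvstar A ->
  literal t = None -> aoplus A (eval A v t) (azero A) = eval A v t.
Proof.
  intros HA. induction t as [j| | |t1 _ t2 _|t1 IH|t1 _|t1 _]; simpl; intros H; try easy.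
  - apply (sq_zero0 A HA).
  - apply (sq_unit0 A HA).
  - apply (sq_add0 A HA).
  - rewrite <- (sq_neg0 A HA), <- (sq_negD A HA), IH; [easy|].
    now destruct (literal t1).
  - rewrite (sq_plusE A HA). apply (sq_add0 A HA).
  - rewrite (sq_minusE A HA). apply (sq_add0 A HA).
Qed.

Lemma minus1_le1 : -1 <= 1.
Proof. lra. Qed.

Definition S_corner : Spt := MkS 1 1 minus1_le1 one_le1 minus1_le1 one_le1.

(** At [S_corner] a literal has second coordinate [1] or [-1], whereas a value with [x ⊕ 0 = x] has
    second coordinate [0]. *)
Lemma literal_mixed t s c : literal t = Some c -> literal s = None -> ~ Sstar_models t s.
Proof.
  intros Ht Hs H. specialize (H (fun _ => S_corner)). destruct c as [b i].
  pose proof (literal_none_regular Sstar (fun _ => S_corner) s Sstar_sqmvstar Hs) as R.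
  rewrite <- H, (literal_eval Sstar _ t b i Sstar_sqmvstar Ht) in R.
  apply (f_equal sb) in R. destruct b; simpl in R; lra.
Qed.

(** With [S_corner] at variable [i] and zero elsewhere, the second coordinate is nonzero only for
    literals in [i], and its sign gives the parity of the negations. *)
Lemma literal_inj t s c d : literal t = Some c -> literal s = Some d ->
  Sstar_models t s -> c = d.
Proof.
  destruct c as [b i], d as [b' j]. intros Ht Hs H.
  specialize (H (fun k => if Nat.eqb k i then S_corner else S_zero)).
  rewrite (literal_eval Sstar _ t b i Sstar_sqmvstar Ht) in H.
  rewrite (literal_eval Sstar _ s b' j Sstar_sqmvstar Hs) in H.
  apply (f_equal sb) in H. rewrite Nat.eqb_refl in H.
  destruct (Nat.eqb_spec j i) as [->|E]; destruct b, b'; simpl in H; try lra; easy.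
Qed.

Theorem theorem3p1 (t s : term) :
  SQMV_models t s <-> Sstar_models t s.
Proof.
  split.
  - intros H. exact (H Sstar Sstar_sqmvstar).
  - intros H A HA v.
    destruct (literal t) as [c|] eqn:Ht, (literal s) as [d|] eqn:Hs.
    + pose proof (literal_inj t s c d Ht Hs H) as <-. destruct c as [b i].
      now rewrite (literal_eval A v t b i HA Ht), (literal_eval A v s b i HA Hs).
    + now destruct (literal_mixed t s c Ht Hs).
    + destruct (literal_mixed s t d Hs Ht). intros w. symmetry. apply H.
    + destruct (Sstar_models_trans t s H) as [V1 V2].
      destruct (trans_eval A HA v t s V1 V2) as [E1 E2].
      apply (regular_ext A HA); [| |exact E1|exact E2]; now apply literal_none_regular.
Qed.
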